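(* For $(\omega,\epsilon)\in B_n$, let $\rho_{\omega,\epsilon}$ be the fundamental cycle of the spherical poset $\overline\Pi_{\omega,\epsilon}$. Then $\{\rho_{\omega,\epsilon}: (\omega,\epsilon)\in B_n$ and all right-to-left maxima of $(\omega,\epsilon)$ are unbarred$\}$ is a basis for $\widetilde H_{n-2}(\overline{\Pi^B_n};\mathbb{Z})$.
   Context: $B_n$ is the set of signed permutations $(\omega,\epsilon)$, $\omega\in S_n$, $\epsilon\in\{-1,1\}^n$, where $\omega(i)$ is barred iff $\epsilon_i=-1$; $\omega(i)$ is a right-to-left maximum if $\omega(i)>\omega(j)$ for all $j>i$. Signed partitions: partitions of $\{0,1,\dots,n\}$ in which nonminimal elements of blocks not containing $0$ (nonzero blocks) may be barred; the zero block (containing $0$) has no bars. For a block $b$, $\bar b$ toggles the bar on every element and $\widetilde b$ removes all bars. $\Pi^B_n$ is the poset of signed partitions with $\pi\le\tau$ iff for each block $b$ of $\pi$, either $b$ or $\bar b$ is contained (as a set of signed letters) in a nonzero block of $\tau$, or $\widetilde b$ is contained in the zero block of $\tau$. It has a minimum $\hat0$ and maximum $\hat1$; $\overline{\Pi^B_n}=\Pi^B_n\setminus\{\hat0,\hat1\}$, and homology of a poset is that of its order complex. Splitting: to split $(\omega,\epsilon)$ at positions $i_1<\dots<i_k$ in $\{0,1,\dots,n-1\}$ (put $i_{k+1}=n$; for $k=0$ the result is the one-block partition) form the signed partition with zero block $\{0,\omega(1),\dots,\omega(i_1)\}$ and, for $j=1,\dots,k$, the nonzero block equal to whichever of $b_j=\{(\omega(i_j+1),\epsilon_{i_j+1}),\dots,(\omega(i_{j+1}),\epsilon_{i_{j+1}})\}$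 or $\bar b_j$ has its minimal element unbarred (here $(a,-1)$ means $\bar a$ and $(a,1)$ means $a$). $\Pi_{\omega,\epsilon}$ is the induced subposet of $\Pi^B_n$ of all signed partitions obtained by splitting $(\omega,\epsilon)$; it is isomorphic to the lattice of subsets of $[n]$, so the order complex of its proper part $\overline\Pi_{\omega,\epsilon}$ is an $(n-2)$-sphere, whose fundamental cycle (defined up to sign) is $\rho_{\omega,\epsilon}$. *)

(* Defs.v *)
From HB Require Import structures.
From mathcomp Require Import all_boot all_order all_fingroup all_algebra.
From mathcomp Require Import boolp.

Set Implicit Arguments.
Unset Strict Implicit.
Unset Printing Implicit Defensive.

Import Order.TTheory GRing.Theory.

Local Open Scope ring_scope.
Local Open Scope quotient_scope.

(** * Reduced simplicial homology of order complexes, with coefficients in Z *)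

(* The complexes considered are the order complexes of the induced subposets
   [A] of a finite poset [T].  Everything is graded by the number [k] of
   elements of a chain, so that the index [k] stands for degree [k - 1] and
   [k = 0] is the augmentation degree -1 (spanned by the empty chain). *)

Definition is_simplex d (T : finPOrderType d) (A : {set T}) k
    (t : k.-tuple T) : bool :=
  sorted <%O t && all (mem A) t.

Definition face (T : Type) k (i : 'I_k) (t : k.-tuple T) : k.-1.-tuple T :=
  [tuple tnth t (lift i j) | j < k.-1].

(* For [k = 0] the inner sum is empty: the differential out of degree -1 is
   zero. *)
Definition boundary (T : finType) k (c : {ffun k.-tuple T -> int}) :
    {ffun k.-1.-tuple T -> int} :=
  [ffun u => \sum_(t : k.-tuple T) \sum_(i < k | face i t == u)
               (-1) ^+ i * c t].

Definition chains d (T : finPOrderType d) (A : {set T}) k :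
    {pred {ffun k.-tuple T -> int}} :=
  [pred c : {ffun k.-tuple T -> int} |
     [forall t, (c t != 0) ==> is_simplex A t]].

Arguments chains {d T} A k.

Definition cycles d (T : finPOrderType d) (A : {set T}) k :
    {pred {ffun k.-tuple T -> int}} :=
  [pred c | (c \in chains A k) && (boundary c == 0)].

Arguments cycles {d T} A k.

Lemma boundaryB (T : finType) k (c c' : {ffun k.-tuple T -> int}) :
  boundary (c - c') = boundary c - boundary c'.
Proof.
apply/ffunP=> u; rewrite !ffunE -sumrB; apply: eq_bigr => t _.
by rewrite -sumrB; apply: eq_bigr => i _; rewrite !ffunE mulrBr.
Qed.

Lemma boundary0 (T : finType) k : boundary (0 : {ffun k.-tuple T -> int}) = 0.
Proof. by rewrite -(subrr 0) boundaryB subrr. Qed.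

Lemma chains_zmod_closed d (T : finPOrderType d) (A : {set T}) k :
  zmod_closed (chains A k).
Proof.
split=> [|c c' /forallP Ac /forallP Ac'].
  by apply/forallP => t; rewrite ffunE eqxx.
apply/forallP => t; apply/implyP; rewrite !ffunE.
have [ct0|ct_neq0 _] := eqVneq (c t) 0; last exact: implyP (Ac t) ct_neq0.
by rewrite ct0 sub0r oppr_eq0 => c't_neq0; apply: implyP (Ac' t) c't_neq0.
Qed.

Lemma cycles_zmod_closed d (T : finPOrderType d) (A : {set T}) k :
  zmod_closed (cycles A k).
Proof.
have [ch0 chB] := chains_zmod_closed A k.
split=> [|c c' /andP[Ac /eqP dc] /andP[Ac' /eqP dc']]; rewrite inE.
  by rewrite ch0 boundary0 eqxx.
by rewrite chB //= boundaryB dc dc' subrr.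
Qed.

HB.instance Definition _ d (T : finPOrderType d) (A : {set T}) k :=
  GRing.isZmodClosed.Build {ffun k.-tuple T -> int} (cycles A k)
    (cycles_zmod_closed A k).

Record chain_cycle d (T : finPOrderType d) (A : {set T}) k := Cycle {
  cycle_chain :> {ffun k.-tuple T -> int};
  cycle_chainP : cycle_chain \in cycles A k
}.

HB.instance Definition _ d (T : finPOrderType d) (A : {set T}) k :=
  [isSub for @cycle_chain d T A k].
HB.instance Definition _ d (T : finPOrderType d) (A : {set T}) k :=
  [Choice of chain_cycle A k by <:].
HB.instance Definition _ d (T : finPOrderType d) (A : {set T}) k :=
  [SubChoice_isSubZmodule of chain_cycle A k by <:].

Definition boundaries d (T : finPOrderType d) (A : {set T}) k :
    {pred chain_cycle A k} :=
  [pred z : chain_cycle A k |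
     `[< exists2 c : {ffun k.+1.-tuple T -> int},
           c \in chains A k.+1 & val z = boundary c >] ].

Arguments boundaries {d T} A k.

Lemma boundaries_zmod_closed d (T : finPOrderType d) (A : {set T}) k :
  zmod_closed (boundaries A k).
Proof.
have [ch0 chB] := chains_zmod_closed A k.+1.
split=> [|z z' /asboolP[c Ac zE] /asboolP[c' Ac' z'E]]; apply/asboolP.
  by exists 0; rewrite ?boundary0.
by exists (c - c'); [exact: chB | rewrite boundaryB -zE -z'E].
Qed.

HB.instance Definition _ d (T : finPOrderType d) (A : {set T}) k :=
  GRing.isZmodClosed.Build (chain_cycle A k) (boundaries A k)
    (boundaries_zmod_closed A k).

(* The reduced homology group of the order complex of [A] in degree [k - 1]. *)
Definition homology d (T : finPOrderType d) (A : {set T}) k : zmodType :=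
  Quotient.quot (boundaries A k).

Definition homology_class d (T : finPOrderType d) (A : {set T}) k
    (z : chain_cycle A k) : homology A k :=
  \pi_(Quotient.quot (boundaries A k)) z.

Lemma cyclesS d (T : finPOrderType d) (A B : {set T}) k :
  A \subset B -> {subset cycles A k <= cycles B k}.
Proof.
move=> /subsetP sAB c /andP[/forallP Ac dc]; apply/andP; split=> //.
apply/forallP => t; apply/implyP => /(implyP (Ac t)) /andP[st tA].
by rewrite /is_simplex st; apply: sub_all tA => x; apply: sAB.
Qed.

Definition cycle_incl d (T : finPOrderType d) (A B : {set T}) k
    (sAB : A \subset B) (z : chain_cycle A k) : chain_cycle B k :=
  Cycle (cyclesS sAB (cycle_chainP z)).

Definition is_Zbasis (M : zmodType) (I : finType) (e : I -> M) : Prop :=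
  (forall x : M, exists a : I -> int, x = \sum_i e i *~ a i) /\
  (forall a : I -> int, \sum_i e i *~ a i = 0 -> forall i, a i = 0).

(* A fundamental cycle, in degree [k - 1], of a complex whose homology in that
   degree is infinite cyclic: a cycle whose class generates it freely.  This
   determines the homology class up to sign. *)
Definition is_fundamental_cycle d (T : finPOrderType d) (A : {set T}) k
    (z : chain_cycle A k) : Prop :=
  is_Zbasis (fun _ : unit => homology_class z).

(* [A] deprived of its minimum and its maximum. *)
Definition proper_part d (T : finPOrderType d) (A : {set T}) : {set T} :=
  [set x in A | ~~ [forall y in A, (x <= y)%O] & ~~ [forall y in A, (y <= x)%O]].

Lemma proper_partS d (T : finPOrderType d) (A B : {set T}) :
  A \subset B -> proper_part A \subset proper_part B.
Proof.
move=> /subsetP sAB; apply/subsetP => x; rewrite !inE => /and3P[xA nmin nmax].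
rewrite sAB //=; apply/andP; split.
  apply: contra nmin => /'forall_implyP minx.
  by apply/'forall_implyP => y /sAB; apply: minx.
apply: contra nmax => /'forall_implyP maxx.
by apply/'forall_implyP => y /sAB; apply: maxx.
Qed.

(** * Signed partitions of {0, 1, ..., n} *)

(* [(a, false)] is the letter a and [(a, true)] is the barred letter a. *)
Definition letter (n : nat) : predArgType := ('I_n.+1 * bool)%type.

Definition bar n (b : {set letter n}) : {set letter n} :=
  [set (l.1, ~~ l.2) | l in b].

Definition unbar n (b : {set letter n}) : {set letter n} :=
  [set (l.1, false) | l in b].

Definition zero_block n (b : {set letter n}) : bool :=
  [exists l in b, l.1 == ord0].

Definition is_signed_partition n (P : {set {set letter n}}) : bool :=
  [&& set0 \notin P, trivIset P,
      [forall a, ((a, false) \in cover P) (+) ((a, true) \in cover P)] &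
      [forall b in P, forall l in b,
         l.2 ==> ~~ zero_block b && [exists l' in b, (l'.1 < l.1)%N]]].

Record signed_partition (n : nat) := SignedPartition {
  blocks :> {set {set letter n}};
  blocksP : is_signed_partition blocks
}.

HB.instance Definition _ n := [isSub for @blocks n].
HB.instance Definition _ n := [Finite of signed_partition n by <:].

Definition sp_le n (p q : signed_partition n) : bool :=
  [forall b in blocks p, exists c in blocks q,
     if zero_block c then unbar b \subset c
     else (b \subset c) || (bar b \subset c)].

Lemma in_bar n (b : {set letter n}) l : (l \in bar b) = ((l.1, ~~ l.2) \in b).
Proof.
apply/imsetP/idP => [[l' bl' ->]|bl]; first by rewrite /= negbK -surjective_pairing.
by exists (l.1, ~~ l.2) => //=; rewrite negbK -surjective_pairing.
Qed.

Lemma barK n : involutive (@bar n).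
Proof. by move=> b; apply/setP => l; rewrite !in_bar /= negbK -surjective_pairing. Qed.

Lemma barS n (b c : {set letter n}) : b \subset c -> bar b \subset bar c.
Proof. exact: imsetS. Qed.

Lemma unbarS n (b c : {set letter n}) : b \subset c -> unbar b \subset unbar c.
Proof. exact: imsetS. Qed.

Lemma unbar_bar n (b : {set letter n}) : unbar (bar b) = unbar b.
Proof. by rewrite /unbar /bar -imset_comp. Qed.

Lemma unbarK n (b : {set letter n}) : unbar (unbar b) = unbar b.
Proof. by rewrite /unbar -imset_comp. Qed.

Lemma zero_block_unbar n (b : {set letter n}) :
  zero_block (unbar b) = zero_block b.
Proof.
apply/existsP/existsP => -[l /andP[bl l0]].
  by case/imsetP: bl l0 => l' bl' -> /= l'0; exists l'; rewrite bl'.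
by exists (l.1, false); rewrite l0 andbT; apply: imset_f.
Qed.

Lemma zero_blockS n (b c : {set letter n}) :
  b \subset c -> zero_block b -> zero_block c.
Proof.
by move=> /subsetP bc /existsP[l /andP[/bc cl l0]]; apply/existsP; exists l; rewrite cl.
Qed.

Lemma zero_block_bar n (b : {set letter n}) : zero_block (bar b) = zero_block b.
Proof. by rewrite -zero_block_unbar unbar_bar zero_block_unbar. Qed.

Section SignedPartitionTheory.
Variables (n : nat) (p : signed_partition n).

Lemma sp_nonempty b : b \in blocks p -> exists l, l \in b.
Proof.
case/and4P: (blocksP p) => p0 _ _ _ pb; apply/set0Pn.
by apply: contraNneq p0 => <-.
Qed.

Lemma sp_letter_uniq b c a e e' : b \in blocks p -> c \in blocks p ->
  (a, e) \in b -> (a, e') \in c -> e = e' /\ b = c.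
Proof.
case/and4P: (blocksP p) => _ /trivIsetP tI /forallP/(_ a) once _ pb pc bae cae'.
have cov b' l : b' \in blocks p -> l \in b' -> l \in cover (blocks p).
  by move=> pb' b'l; apply/bigcupP; exists b'.
have ee' : e = e'.
  move: once (cov b _ pb bae) (cov c _ pc cae').
  by case: e bae => bae; case: e' cae' => cae' // + H1 H2; rewrite H1 H2.
split=> //; apply/eqP; apply: contraT => /(tI _ _ pb pc).
by move=> /pred0P/(_ (a, e)) /=; rewrite bae ee' cae'.
Qed.

Lemma sp_min b l : b \in blocks p -> l \in b ->
  (forall l', l' \in b -> (l.1 <= l'.1)%N) -> l.2 = false.
Proof.
case/and4P: (blocksP p) => _ _ _ /forall_inP h pb bl lmin.
apply/negbTE/negP => l2; move/forall_inP: (h b pb) => /(_ l bl).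
rewrite l2 /= => /andP[_ /existsP[l' /andP[bl']]].
by rewrite ltnNge lmin.
Qed.

Lemma sp_zero_unbar b : b \in blocks p -> zero_block b -> unbar b = b.
Proof.
case/and4P: (blocksP p) => _ _ _ /forall_inP h pb b0.
have l2 l : l \in b -> l = (l.1, false).
  move=> bl; case: l bl => a [] // bl.
  by move/forall_inP: (h b pb) => /(_ _ bl); rewrite /= b0.
apply/setP => l; apply/imsetP/idP => [[l' bl' ->]|bl]; first by rewrite -l2.
by exists l => //; apply: l2.
Qed.

Lemma sp_zero_uniq b c : b \in blocks p -> c \in blocks p ->
  zero_block b -> zero_block c -> b = c.
Proof.
move=> pb pc /existsP[[a e] /andP[bl /eqP /= a0]] /existsP[[a' e'] /andP[cl /eqP /= a'0]].
by rewrite a0 in bl; rewrite a'0 in cl; case: (sp_letter_uniq pb pc bl cl).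
Qed.

End SignedPartitionTheory.

Lemma sp_le_refl n : reflexive (@sp_le n).
Proof.
move=> p; apply/forall_inP => b pb; apply/existsP; exists b; rewrite pb /=.
by case: ifP => [b0|_]; rewrite ?(sp_zero_unbar pb b0) subxx.
Qed.

Lemma sp_le_trans n : transitive (@sp_le n).
Proof.
move=> q p r /forall_inP pq /forall_inP qr; apply/forall_inP => b pb.
case/existsP: (pq b pb) => c /andP[qc bc].
case/existsP: (qr c qc) => d /andP[rd cd].
apply/existsP; exists d; rewrite rd /=.
have [d0|d0] := boolP (zero_block d); rewrite ?d0 ?(negbTE d0) in cd *.
  apply: subset_trans cd; case: ifP bc => [c0 bc|_ /orP[]].
  - by rewrite -(unbarK b); apply: unbarS.
  - exact: unbarS.
  - by move/unbarS; rewrite unbar_bar.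
have c0 : ~~ zero_block c.
  apply: contra d0; case/orP: cd => /zero_blockS cd; first exact: cd.
  by rewrite -zero_block_bar.
rewrite (negbTE c0) in bc; case/orP: cd => cd; case/orP: bc => bc.
- by rewrite (subset_trans bc cd).
- by rewrite (subset_trans bc cd) orbT.
- by rewrite (subset_trans (barS bc) cd) orbT.
- by move: (subset_trans (barS bc) cd); rewrite barK => ->.
Qed.

Lemma sp_le_sub n (p q : signed_partition n) :
  sp_le p q -> sp_le q p -> blocks p \subset blocks q.
Proof.
move=> /forall_inP pq /forall_inP qp; apply/subsetP => b pb.
case/existsP: (pq b pb) => c /andP[qc].
case/existsP: (qp c qc) => d /andP[pd].
have [l bl] := sp_nonempty pb.
case: ifP => [d0 cd|d0 cd]; case: ifP => [c0 bc|c0 bc].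
- have bd : unbar b \subset d by apply: subset_trans cd; rewrite -(unbarK b) unbarS.
  have b_d : b = d.
    have : (l.1, false) \in d by apply: (subsetP bd); apply: imset_f.
    move=> dl; rewrite (surjective_pairing l) in bl.
    by case: (sp_letter_uniq pb pd bl dl).
  rewrite -b_d in d0 cd bd.
  suff -> : b = c by [].
  apply/eqP; rewrite eqEsubset -{1}(sp_zero_unbar pb d0) bc.
  by rewrite -(sp_zero_unbar qc c0).
- have : zero_block (unbar c).
    case/existsP: d0 => l0 /andP[dl0 l00].
    rewrite zero_block_unbar.
    have b_d : b = d.
      have bd : unbar b \subset d.
        apply: subset_trans cd; case/orP: bc => bc; first exact: unbarS.
        by rewrite -unbar_bar unbarS.
      have : (l.1, false) \in d by apply: (subsetP bd); apply: imset_f.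
      move=> dl; rewrite (surjective_pairing l) in bl.
      by case: (sp_letter_uniq pb pd bl dl).
    have b0 : zero_block b by rewrite b_d; apply/existsP; exists l0; rewrite dl0.
    by case/orP: bc => /zero_blockS; [|rewrite zero_block_bar]; apply.
  by rewrite zero_block_unbar c0.
- suff : zero_block d by rewrite d0.
  by case/orP: cd => /zero_blockS; [|rewrite zero_block_bar]; apply.
- have b_d : b = d.
    have [e dl] : exists e, (l.1, e) \in d.
      case/orP: bc => /subsetP bc; case/orP: cd => /subsetP cd.
      - by exists l.2; rewrite -surjective_pairing; apply/cd/bc.
      - exists (~~ l.2); apply: cd.
        by rewrite in_bar /= negbK -surjective_pairing; apply: bc.
      - exists (~~ l.2); apply: cd; apply: bc.
        by rewrite in_bar /= negbK -surjective_pairing.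
      - exists l.2; apply: cd; rewrite in_bar; apply: bc.
        by rewrite in_bar /= negbK -surjective_pairing.
    rewrite (surjective_pairing l) in bl.
    by case: (sp_letter_uniq pb pd bl dl).
  rewrite -b_d in cd.
  have bar_inj : injective (@bar n) := inv_inj (@barK n).
  have card_bar (x : {set letter n}) : #|bar x| = #|x|.
    by apply: card_imset => -[x1 x2] [y1 y2] [-> /negb_inj ->].
  have le_bc : (#|b| <= #|c|)%N.
    by case/orP: bc => /subset_leq_card; rewrite ?card_bar.
  have le_cb : (#|c| <= #|b|)%N.
    by case/orP: cd => /subset_leq_card; rewrite ?card_bar.
  case/orP: bc => bc.
    have /eqP -> // : b == c by rewrite eqEcard bc.
  have {bc} /eqP bc : bar b == c by rewrite eqEcard bc card_bar.
  case: (@arg_minnP _ l (mem b) (fun l : letter n => l.1 : nat) bl) => m bm mmin.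
  have m2 := sp_min pb bm mmin.
  have cm : (m.1, ~~ m.2) \in c by rewrite -bc in_bar /= negbK -surjective_pairing.
  have := @sp_min _ q c (m.1, ~~ m.2) qc cm.
  rewrite m2 /= => cmin; suff: true = false by [].
  by apply: cmin => l'; rewrite -bc in_bar => /mmin.
Qed.

Lemma sp_le_anti n : antisymmetric (@sp_le n).
Proof.
move=> p q /andP[pq qp]; apply/val_inj/eqP.
by rewrite eqEsubset !sp_le_sub.
Qed.

HB.instance Definition _ n :=
  Order.Le_isPOrder.Build (Order.Disp tt tt) (signed_partition n)
    (@sp_le_refl n) (@sp_le_anti n) (@sp_le_trans n).

(** * Signed permutations and their splittings *)

(* Positions and values of a permutation are numbered from 0: position [i] is
   position i + 1 of the word, and the value [w.1 i] stands for the letter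
   w.1 i + 1, that is [lift ord0 (w.1 i)].  The boolean [w.2 i] is [true] when
   the letter in position [i] is barred, i.e. when epsilon = -1. *)
Definition signed_perm (n : nat) : predArgType :=
  ('S_n * {ffun 'I_n -> bool})%type.

Definition right_to_left_max n (w : signed_perm n) (i : 'I_n) : bool :=
  [forall j : 'I_n, (i < j)%N ==> (w.1 j < w.1 i)%N].

Definition rl_maxima_unbarred n (w : signed_perm n) : bool :=
  [forall i, right_to_left_max w i ==> ~~ w.2 i].

Definition normalize_block n (b : {set letter n}) : {set letter n} :=
  if [exists l in b, ~~ l.2 && [forall l' in b, (l.1 <= l'.1)%N]]
  then b else bar b.

(* With the numbering from 0, splitting at [S] starts a new block at each
   position belonging to [S]. *)
Definition split_zero_block n (w : signed_perm n) (S : {set 'I_n}) :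
    {set letter n} :=
  (ord0, false) |: [set (lift ord0 (w.1 i), false)
                     | i : 'I_n & [forall s in S, (i < s)%N]].

Definition split_segment n (w : signed_perm n) (S : {set 'I_n}) (s : 'I_n) :
    {set letter n} :=
  [set (lift ord0 (w.1 i), w.2 i)
    | i : 'I_n & (s <= i)%N && [forall s' in S, (s < s')%N ==> (i < s')%N]].

Definition split_blocks n (w : signed_perm n) (S : {set 'I_n}) :
    {set {set letter n}} :=
  split_zero_block w S |: [set normalize_block (split_segment w S s) | s in S].

Lemma normalize_blockE n (b : {set letter n}) :
  exists e, forall l, (l \in normalize_block b) = ((l.1, l.2 (+) e) \in b).
Proof.
rewrite /normalize_block; case: ifP => _.
  by exists false => l; rewrite addbF -surjective_pairing.
by exists true => l; rewrite in_bar addbT.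
Qed.

Lemma normalize_block_min n (b : {set letter n}) l :
  (forall l1 l2, l1 \in b -> l2 \in b -> l1.1 = l2.1 -> l1 = l2) ->
  l \in normalize_block b -> l.2 ->
  exists2 l', l' \in normalize_block b & (l'.1 < l.1)%N.
Proof.
move=> inj_b; rewrite /normalize_block; case: ifP => [/existsP[m]|].
  case/andP=> bm /andP[m2 /forall_inP mmin] bl l2; exists m => //.
  rewrite ltn_neqAle mmin // andbT; apply: contraNneq m2 => /val_inj ml.
  by rewrite (inj_b m l).
move=> nomin; rewrite in_bar => bl l2.
case: (@arg_minnP _ _ (mem b) (fun l : letter n => l.1 : nat) bl) => m.
rewrite /= => bm mmin; have m2 : m.2.
  apply: contraFT nomin => m2; apply/existsP; exists m; rewrite [m \in b]bm m2 /=.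
  by apply/forall_inP.
exists (m.1, ~~ m.2); first by rewrite in_bar /= negbK -surjective_pairing.
rewrite /= ltn_neqAle (mmin _ bl) andbT; apply/eqP => /val_inj ml.
by have := inj_b _ _ bm bl ml => m_l; move: m2; rewrite m_l /= l2.
Qed.

Section Splitting.
Variables (n : nat) (w : signed_perm n) (S : {set 'I_n}).

Lemma in_split_zero_block (l : letter n) : reflect
  (l = (ord0, false) \/
   exists2 i : 'I_n, (forall s, s \in S -> (i < s)%N)
     & l = (lift ord0 (w.1 i), false))
  (l \in split_zero_block w S).
Proof.
apply: (iffP setU1P) => -[->|]; try by left.
  by case/imsetP=> i; rewrite inE => /forall_inP iS ->; right; exists i.
case=> i iS ->; right; apply: imset_f; rewrite inE; exact/forall_inP.
Qed.

Lemma in_split_segment (s : 'I_n) (l : letter n) : reflect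
  (exists i : 'I_n, [/\ (s <= i)%N,
     forall s', s' \in S -> (s < s')%N -> (i < s')%N
     & l = (lift ord0 (w.1 i), w.2 i)])
  (l \in split_segment w S s).
Proof.
apply: (iffP imsetP) => [[i] | [i [si iS ->]]].
  rewrite inE => /andP[si /forall_inP iS] ->; exists i; split=> // s' Ss'.
  exact/implyP/iS.
by exists i => //; rewrite inE si; apply/forall_inP => s' Ss'; apply/implyP/iS.
Qed.

Lemma split_segment_inj s l1 l2 : l1 \in split_segment w S s ->
  l2 \in split_segment w S s -> l1.1 = l2.1 -> l1 = l2.
Proof.
by move=> /in_split_segment[i [_ _ ->]] /in_split_segment[j [_ _ ->]] /=
  /lift_inj/perm_inj ->.
Qed.

Lemma split_blockP b a e : b \in split_blocks w S -> (a, e) \in b ->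
     (b = split_zero_block w S /\ e = false) /\
     (a = ord0 \/
      exists2 i : 'I_n, (forall s, s \in S -> (i < s)%N) & a = lift ord0 (w.1 i))
  \/ exists i s : 'I_n,
       [/\ s \in S, b = normalize_block (split_segment w S s), (s <= i)%N,
           forall s', s' \in S -> (s < s')%N -> (i < s')%N
           & a = lift ord0 (w.1 i)].
Proof.
case/setU1P=> [->|/imsetP[s Ss ->]].
  case/in_split_zero_block=> [[-> ->]|[i iS [-> ->]]]; left; split=> //.
    by left.
  by right; exists i.
have [e' nE] := normalize_blockE (split_segment w S s).
by rewrite nE => /in_split_segment[i [si iS [-> _]]]; right; exists i, s.
Qed.

Lemma split_block_uniq b c a e e' :
  b \in split_blocks w S -> c \in split_blocks w S ->
  (a, e) \in b -> (a, e') \in c -> e = e' /\ b = c.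
Proof.
move=> Pb Pc bae cae'.
have lift0F i : ord0 = lift ord0 (w.1 i) -> False by move=> /(congr1 val).
case: (split_blockP Pb bae) => [[[bE eE] aE]|[i [s [Ss bE si iS aE]]]];
case: (split_blockP Pc cae') => [[[cE e'E] a'E]|[j [s' [Ss' cE s'j jS a'E]]]].
- by rewrite bE cE eE e'E.
- case: aE => [a0|[i iS aE]]; first by case: (lift0F j); rewrite -a'E.
  have ij : i = j by apply: (@perm_inj _ w.1); apply: (@lift_inj _ ord0); rewrite -aE.
  by have := iS _ Ss'; rewrite ij ltnNge s'j.
- case: a'E => [a0|[j jS a'E]]; first by case: (lift0F i); rewrite -aE.
  have ij : i = j by apply: (@perm_inj _ w.1); apply: (@lift_inj _ ord0); rewrite -aE.
  by have := jS _ Ss; rewrite -ij ltnNge si.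
have ij : i = j by apply: (@perm_inj _ w.1); apply: (@lift_inj _ ord0); rewrite -aE.
have ss' : s = s'.
  apply: val_inj; case: (ltngtP s s') => // [lt|lt].
    by have := iS _ Ss' lt; rewrite ij ltnNge s'j.
  by have := jS _ Ss lt; rewrite -ij ltnNge si.
rewrite bE cE ss'; split=> //.
have [f nE] := normalize_blockE (split_segment w S s).
move: bae cae'; rewrite bE cE -ss' !nE /= => h h'.
by case: (split_segment_inj h h' erefl) => /addIb.
Qed.

Lemma split_blocksP : is_signed_partition (split_blocks w S).
Proof.
apply/and4P; split.
- apply/negP => /setU1P[/setP/(_ (ord0, false))|/imsetP[s Ss]].
    by rewrite in_set0 setU11.
  have [e nE] := normalize_blockE (split_segment w S s).
  move=> /setP/(_ (lift ord0 (w.1 s), w.2 s (+) e)); rewrite nE in_set0 /=.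
  rewrite addbK => /esym/negP[]; apply/in_split_segment; by exists s; split.
- apply/trivIsetP => b c Pb Pc; apply: contraR => /pred0Pn[[a e] /andP[/= ba ca]].
  by apply/eqP; case: (split_block_uniq Pb Pc ba ca).
- apply/forallP => a.
  have [e [b Pb bae]] : exists e, exists2 b, b \in split_blocks w S & (a, e) \in b.
    case: (unliftP ord0 a) => [a'|] ->; last first.
      by exists false, (split_zero_block w S); rewrite setU11.
    pose i := (w.1^-1 a')%g; have wi : w.1 i = a' by rewrite permKV.
    have [/forall_inP iS|] := boolP [forall s in S, (i < s)%N].
      exists false, (split_zero_block w S); first by rewrite setU11.
      by apply/in_split_zero_block; right; exists i; rewrite ?wi.
    rewrite negb_forall_in => /existsP[s0 /andP[Ss0]]; rewrite -leqNgt => s0i.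
    have Q0 : (s0 \in S) && (s0 <= i)%N by rewrite Ss0.
    case: (@arg_maxnP _ s0 (fun s => (s \in S) && (s <= i)%N) (fun s => s : nat) Q0).
    move=> s /andP[Ss si] smax.
    have [e nE] := normalize_blockE (split_segment w S s).
    exists (w.2 i (+) e), (normalize_block (split_segment w S s)).
      by apply/setU1P; right; apply: imset_f.
    rewrite nE /= addbK; apply/in_split_segment; exists i; split=> //.
      move=> s' Ss' lt_ss'; rewrite ltnNge; apply/negP => s'i.
      by have := smax s'; rewrite Ss' s'i => /(_ isT); rewrite /= leqNgt lt_ss'.
    by rewrite wi.
  have cov : (a, e) \in cover (split_blocks w S) by apply/bigcupP; exists b.
  have ncov : (a, ~~ e) \notin cover (split_blocks w S).
    apply/bigcupP => -[c Pc cae].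
    by have [] := split_block_uniq Pb Pc bae cae; case: (e).
  by case: e bae cov ncov => _ /= -> /negbTE ->.
apply/forall_inP => b Pb; apply/forall_inP => -[a e] bae; apply/implyP => /= eT.
rewrite eT in bae; case: (split_blockP Pb bae) => [[[_]] //|].
move=> [i [s [Ss bE si iS aE]]]; apply/andP; split.
  rewrite bE; apply/existsP => -[[a' e'] /andP[]].
  have [f nE] := normalize_blockE (split_segment w S s).
  by rewrite nE /= => /in_split_segment[j [_ _ [-> _]]].
rewrite bE in bae *.
have [] := normalize_block_min (@split_segment_inj s) bae isT.
by move=> l' bl' ltl'; apply/existsP; exists l'; rewrite bl'.
Qed.

End Splitting.

Definition split_partition n (w : signed_perm n) (S : {set 'I_n}) :
    signed_partition n :=
  SignedPartition (split_blocksP w S).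

Definition split_poset n (w : signed_perm n) : {set signed_partition n} :=
  [set split_partition w S | S : {set 'I_n}].

(* Main.v *)
Require Import Defs.
From mathcomp Require Import all_boot all_order all_fingroup all_algebra.
From mathcomp Require Import zify boolp.

(** The chains of length n - 1 are the facets of the complex and there are no
    longer ones, so the homology is the group of top cycles: integer functions
    on maximal chains x_1 < ... < x_(n-1) whose sum over all choices of any
    single x_i vanishes.

    Call a maximal chain typed if in each x_i the letters i + 1, ..., n lie in
    pairwise distinct nonzero blocks.  A cycle vanishing on all typed chains is
    zero, because a partition in which the letter k is not isolated covers at
    most one partition in which k is isolated.

    A typed chain records, for each letter k, the signed letter v(k) (0 or
    larger than k in absolute value) with which k gets identified in x_k.  Put
    the signed letters on the integer line by cpos(k) = cpos(v(k)) + 3^k and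
    cpos(-k) = - cpos(k); reading off the positive positions gives a signed
    permutation, and exactly those with unbarred right-to-left maxima arise.
    The partition x_k is recovered by rounding positions to multiples of
    3^(k+1), so the typed chain of w consists of splittings of w.  If the typed
    chain of v lies in the splitting poset of the permutation of u, convexity of
    blocks shows that v = u or that v is lexicographically larger (largest
    letters first).  Hence the matrix of values of the cycles rho on the typed
    chains is triangular with diagonal entries +-1. *)

Set Implicit Arguments.
Unset Strict Implicit.
Unset Printing Implicit Defensive.

Import Order.TTheory GRing.Theory Num.Theory.

Local Open Scope ring_scope.
Local Open Scope quotient_scope.

(** * Signed partitions as equivalence relations on signed letters *)

Definition neg n (l : letter n) : letter n := (l.1, ~~ l.2).

(** Equality up to the bar on 0: the type [letter] contains a barred 0, which denotes 0 again. *)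
Definition same n (l l' : letter n) : bool :=
  (l.1 == l'.1) && ((l.1 == ord0) || (l.2 == l'.2)).

(** A nonzero block stands for two classes, itself and its bar; the zero block stands for a single
    class holding its letters with both signs. *)
Definition eqv_in n (c : {set letter n}) (l l' : letter n) : bool :=
  if zero_block c then ((l.1, false) \in c) && ((l'.1, false) \in c)
  else (l \in c) && (l' \in c) || (neg l \in c) && (neg l' \in c).

(* The class of 0 consists of the letters equivalent to their own negative. *)
Definition eqv n (p : signed_partition n) (l l' : letter n) : bool :=
  [exists c in blocks p, eqv_in c l l'].

Section Eqv.
Variable n : nat.
Implicit Types (p q : signed_partition n) (l r : letter n) (c : {set letter n}).

Lemma negK : involutive (@neg n).
Proof. by case=> a e; rewrite /neg /= negbK. Qed.

Lemma eqvP p l l' :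
  reflect (exists2 c, c \in blocks p & eqv_in c l l') (eqv p l l').
Proof.
by apply: (iffP existsP) => -[c]; [case/andP=> ? ?; exists c | exists c; apply/andP].
Qed.

Lemma sp_cover p a : exists e, exists2 c, c \in blocks p & (a, e) \in c.
Proof.
case/and4P: (blocksP p) => _ _ /forallP/(_ a) H _.
have : ((a, false) \in cover (blocks p)) || ((a, true) \in cover (blocks p)).
  by case: (_ \in _) H => //=; case: (_ \in _).
by case/orP=> /bigcupP[c pc ca]; [exists false | exists true]; exists c.
Qed.

Lemma zero_block_false p c l :
  c \in blocks p -> zero_block c -> l \in c -> l = (l.1, false).
Proof.
move=> pc c0 cl; have := sp_zero_unbar pc c0 => cE.
by move: cl; rewrite -{1}cE => /imsetP[l' _ ->].
Qed.

Lemma zero_block0 c e : (ord0, e) \in c -> zero_block c.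
Proof. by move=> h; apply/existsP; exists (ord0, e); rewrite h eqxx. Qed.

Lemma eqv_in_sym c l l' : eqv_in c l l' = eqv_in c l' l.
Proof.
by rewrite /eqv_in; case: ifP => _; rewrite ?(andbC (l \in c)) ?(andbC (neg l \in c)) // andbC.
Qed.

Lemma eqv_in_refl p c a e e' :
  c \in blocks p -> (a, e) \in c -> eqv_in c (a, e') (a, e').
Proof.
move=> pc ca; rewrite /eqv_in; case: ifP => c0.
  by have := zero_block_false pc c0 ca => -[ee]; rewrite -ee ca.
by rewrite /neg !andbb /=; case: e e' ca => -[] ->; rewrite ?orbT.
Qed.

Lemma eqv_in_fst c l l' : eqv_in c l l' -> exists e, (l.1, e) \in c.
Proof.
case: l => a e; rewrite /eqv_in /neg /=; case: ifP => _.
  by case/andP => h _; exists false.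
by case/orP=> /andP[h _]; eexists; apply: h.
Qed.

Lemma eqv_in_uniq p c c' l1 l2 l3 : c \in blocks p -> c' \in blocks p ->
  eqv_in c l1 l2 -> eqv_in c' l2 l3 -> c = c'.
Proof.
move=> pc pc'; rewrite eqv_in_sym => /eqv_in_fst[e h] /eqv_in_fst[e' h'].
by have [] := sp_letter_uniq pc pc' h h'.
Qed.

Lemma eqv_refl p l : eqv p l l.
Proof.
case: l => a e; have [e' [c pc ca]] := sp_cover p a.
by apply/eqvP; exists c => //; apply: eqv_in_refl pc ca.
Qed.

Lemma eqv_sym p l l' : eqv p l l' = eqv p l' l.
Proof. by apply: eq_existsb => c; rewrite eqv_in_sym. Qed.

Lemma eqv_trans p l2 l1 l3 : eqv p l1 l2 -> eqv p l2 l3 -> eqv p l1 l3.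
Proof.
move=> /eqvP[c pc h] /eqvP[c' pc' h'].
have cc' := eqv_in_uniq pc pc' h h'; rewrite -{c' pc'}cc' in h'.
apply/eqvP; exists c => //; move: h h'; rewrite /eqv_in; case: ifP => _.
  by move=> /andP[-> _] /andP[_ ->].
case: l2 => a e; rewrite /neg /=.
have F : (a, e) \in c -> (a, ~~ e) \in c -> False.
  by move=> h h'; have [] := sp_letter_uniq pc pc h h'; case: (e).
case/orP=> /andP[h1 h2]; case/orP=> /andP[h3 h4].
- by rewrite h1 h4.
- by case: (F h2 h3).
- by case: (F h3 h2).
- by rewrite h1 h4 orbT.
Qed.

Lemma eqv_neg p l l' : eqv p (neg l) (neg l') = eqv p l l'.
Proof.
apply: eq_existsb => c; congr (_ && _).
by rewrite /eqv_in !negK; case: ifP => _ //; rewrite orbC.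
Qed.

Lemma eqv0 p e e' : eqv p (ord0, e) (ord0, e').
Proof.
have [f [c pc c0]] := sp_cover p ord0.
have z := zero_block0 c0; apply/eqvP; exists c => //.
rewrite /eqv_in z /=.
by have := zero_block_false pc z c0 => -[ff]; rewrite -ff c0.
Qed.

Lemma eqv_same p l l' : same l l' -> eqv p l l'.
Proof.
case: l l' => [a e] [a' e'] /andP[/= /eqP <- /orP[/eqP ->|/eqP <-]].
  exact: eqv0.
exact: eqv_refl.
Qed.

Lemma eqv_neg0 p l e : eqv p l (neg l) -> eqv p l (ord0, e).
Proof.
case: l => a f /eqvP[c pc]; rewrite /eqv_in /neg /= negbK.
case: ifP => [c0 /andP[ca _]|_].
  apply/eqvP; exists c => //; rewrite /eqv_in c0 /= ca /=.
  case/existsP: c0 (c0) => -[a0 f0] /andP[h /eqP /= a00] c0; rewrite a00 in h.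
  by have := zero_block_false pc c0 h => -[ff]; rewrite -ff.
by case/orP=> /andP[h h']; have [] := sp_letter_uniq pc pc h h'; case: (f).
Qed.

(** For the converse, fix a letter of a block [b] of [p] and the block [c] of [q] holding it with
    some sign. All of [b] is equivalent to that letter under [q], so for nonzero [c] either [b] or
    [bar b] lies in [c], according to whether the two signs agree. *)
Lemma eqv_leP p q : (p <= q)%O <-> (forall l l', eqv p l l' -> eqv q l l').
Proof.
split=> [/forall_inP pq l l' /eqvP[b pb h]|H].
  case/existsP: (pq b pb) => c /andP[qc bc]; apply/eqvP; exists c => //.
  have U x : ((x.1, false) \in unbar b) = ((x \in b) || (neg x \in b)).
    case: x => a e; apply/imsetP/orP => [[[a' e'] h' /= [->]]|[]h'].
    - by move: h'; case: e' e => -[]; rewrite /neg /=; auto.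
    - by exists (a, e).
    - by exists (a, ~~ e).
  move: h bc; rewrite /eqv_in; have [b0|b0] := boolP (zero_block b).
    case/andP=> h h'; case: ifP => [_|c0].
      by rewrite (sp_zero_unbar pb b0) => /subsetP bc; rewrite !bc.
    by move=> /orP[] /zero_blockS; rewrite ?zero_block_bar b0 c0 => /(_ isT).
  case: ifP => c0 h.
    by move=> /subsetP bc; rewrite !bc // U; case/orP: h => /andP[h h'];
      rewrite ?h ?h' ?orbT.
  case/orP=> /subsetP bc; case/orP: h => /andP[h h'].
  - by rewrite (bc _ h) (bc _ h').
  - by rewrite (bc _ h) (bc _ h') orbT.
  - by rewrite (bc (neg l)) ?(bc (neg l')) ?orbT // in_bar /= negbK -surjective_pairing.
  - by rewrite (bc l) ?(bc l') // in_bar.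
apply/forall_inP => b pb; have [[a e] ba] := sp_nonempty pb.
have [f [c qc ca]] := sp_cover q a.
have ebq l : l \in b -> eqv_in c (a, e) l.
  move=> bl; have : eqv p (a, e) l.
    apply/eqvP; exists b => //; rewrite /eqv_in ba bl; case: ifP => b0 //=.
    rewrite -(zero_block_false pb b0 bl) bl.
    by have := zero_block_false pb b0 ba => -[ee]; rewrite -ee ba.
  move/H/eqvP=> [c' qc' h]; have [f' h'] := eqv_in_fst h.
  by have [_ ->] := sp_letter_uniq qc qc' ca h'.
apply/existsP; exists c; rewrite qc /=; case: ifP => c0.
  apply/subsetP => l /imsetP[l' /ebq]; rewrite /eqv_in c0 => /andP[_ h] ->; exact: h.
have F g : (a, g) \in c -> (a, ~~ g) \in c -> False.
  by move=> h h'; have [] := sp_letter_uniq qc qc h h'; case: (g).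
have [ef|ef] := eqVneq e f.
  apply/orP; left; apply/subsetP => l /ebq; rewrite /eqv_in c0 -ef in ca *.
  by case/orP=> /andP[h h'] //; case: (F _ ca h).
have fE : f = ~~ e by case: (e) (f) ef => -[].
apply/orP; right; apply/subsetP => l; rewrite in_bar => /ebq.
rewrite /eqv_in c0; rewrite fE in ca.
case/orP=> /andP[h h']; first by case: (F _ h ca).
by move: h'; rewrite /neg /= negbK -surjective_pairing.
Qed.

Lemma eqv_le p q l l' : (p <= q)%O -> eqv p l l' -> eqv q l l'.
Proof. by move/eqv_leP; apply. Qed.

Lemma eqv_inj p q : (forall l l', eqv p l l' = eqv q l l') -> p = q.
Proof.
by move=> h; apply/le_anti/andP; split; apply/eqv_leP => l l'; rewrite h.
Qed.

End Eqv.

(** * Leaders and the vanishing criterion for top cycles *)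

(* The letter 0 counts as high for every [k]. *)
Definition high n (k : nat) (l : letter n) : bool :=
  (l.1 == ord0) || (k < l.1)%N.

(** The leaders are the largest letters, bars aside, of the nonzero blocks; their number serves as a
    rank function. *)
Definition leaders n (p : signed_partition n) : {set 'I_n.+1} :=
  [set a | (a != ord0) && [forall l, high a l ==> ~~ eqv p (a, false) l]].

Section Leaders.
Variable n : nat.
Implicit Types (p q y : signed_partition n) (l r s : letter n).

Lemma leaders_neq0 p a : a \in leaders p -> a != ord0.
Proof. by rewrite inE => /andP[]. Qed.

Lemma leaders_eqvF p a e l : a \in leaders p -> high a l -> eqv p (a, e) l = false.
Proof.
rewrite inE => /andP[_ /forallP H] hl; apply/negbTE.
case: e; last exact: implyP (H l) hl.
by rewrite -eqv_neg; apply: implyP (H (neg l)) hl.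
Qed.

Lemma notin_leaders p a : a \notin leaders p -> a = ord0 \/
  exists2 l, high a l & eqv p (a, false) l.
Proof.
rewrite inE negb_and negbK => /orP[/eqP ->|]; first by left.
rewrite negb_forall => /existsP[l]; rewrite negb_imply negbK => /andP[hl e].
by right; exists l.
Qed.

Definition is_rep p r := (r.1 == ord0) || (r.1 \in leaders p).

(** A letter that is neither 0 nor a leader is equivalent to 0 or to a larger letter, and the climb
    is finite. *)
Lemma ex_rep p l : exists2 r, eqv p l r & is_rep p r.
Proof.
have [N] := ubnP (n - l.1)%N; elim: N l => // N IH [a e] /= lt_aN.
have [aL|/notin_leaders[->|[l hl el]]] := boolP (a \in leaders p).
- by exists (a, e); rewrite ?eqv_refl // /is_rep /= aL orbT.
- by exists (ord0, e); rewrite ?eqv_refl.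
have [l' el' l'1] : exists2 l', eqv p (a, e) l' & l'.1 = l.1.
  by case: e => //; [exists (neg l); rewrite // -eqv_neg negK | exists l].
have [l0|l0] := eqVneq l.1 ord0.
  by exists l'; rewrite // /is_rep l'1 l0 eqxx.
have [|r er rr] := IH l'.
  rewrite /high (negbTE l0) /= in hl; rewrite l'1.
  by have := ltn_ord l.1; lia.
by exists r => //; apply: eqv_trans er.
Qed.

Lemma rep_uniq p r s : is_rep p r -> is_rep p s -> eqv p r s -> same r s.
Proof.
case: r s => [a e] [b f]; rewrite /is_rep /same /=.
have [->|a0] := eqVneq a ord0 => /=.
  have [//|b0 _ bL] := eqVneq b ord0.
  by rewrite eqv_sym leaders_eqvF // /high eqxx.
move=> aL; have [->|b0 /= bL] := eqVneq b ord0.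
  by rewrite leaders_eqvF // /high eqxx.
case: (ltngtP a b) => ab.
- by rewrite leaders_eqvF // /high /= ab orbT.
- by rewrite eqv_sym leaders_eqvF // /high /= ab orbT.
move/val_inj: ab => <-; rewrite eqxx /=.
have [//|ef] := eqVneq e f; have -> : (a, f) = neg (a, e).
  by case: e f ef => -[].
by move/(eqv_neg0 false); rewrite leaders_eqvF // /high eqxx.
Qed.

Lemma leaders_le p q : (p <= q)%O -> leaders q \subset leaders p.
Proof.
move=> pq; apply/subsetP => a aL; apply: contraT => /notin_leaders[a0|[l hl e]].
  by have := leaders_neq0 aL; rewrite a0 eqxx.
by have := eqv_le pq e; rewrite leaders_eqvF.
Qed.

(** If [leaders p] were contained in [leaders q], representatives for [p] would also be
    representatives for [q], and [q] would identify nothing new. *)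
Lemma leaders_lt p q : (p < q)%O -> (#|leaders q| < #|leaders p|)%N.
Proof.
move=> pq; apply: proper_card; rewrite properE leaders_le ?ltW //=.
apply: contraL pq => Lqp; have pq : leaders p \subset leaders q -> (p <= q)%O -> (q <= p)%O.
  move=> /subsetP sL pq; apply/eqv_leP => l l' ell'.
  have [r er rr] := ex_rep p l; have [r' er' rr'] := ex_rep p l'.
  have iq s : is_rep p s -> is_rep q s.
    by rewrite /is_rep => /orP[->|/sL ->]; rewrite ?orbT.
  have : same r r'.
    apply: (rep_uniq (iq _ rr) (iq _ rr')).
    have h : eqv q r l by rewrite eqv_sym; apply: eqv_le er.
    by apply: eqv_trans h (eqv_trans ell' (eqv_le pq er')).
  move/(eqv_same p) => h; apply: eqv_trans er (eqv_trans h _).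
  by rewrite eqv_sym.
by apply/negP => lt; move: (pq Lqp (ltW lt)); rewrite lt_geF.
Qed.

Lemma leaders_set0_max p q : leaders p = set0 -> (q <= p)%O.
Proof.
move=> L0; apply/eqv_leP => l l' _.
have [r er rr] := ex_rep p l; have [r' er' rr'] := ex_rep p l'.
apply: eqv_trans er _; rewrite eqv_sym; apply: eqv_trans er' _; apply: eqv_same.
by move: rr rr'; rewrite /is_rep /same L0 !inE !orbF => /eqP -> /eqP ->.
Qed.

Lemma leaders_setT_min p q : (forall a, a != ord0 -> a \in leaders p) -> (p <= q)%O.
Proof.
move=> LT; apply/eqv_leP => l l' /rep_uniq h; apply/eqv_same/h; rewrite /is_rep.
  by have [//|/LT ->] := eqVneq l.1 ord0.
by have [//|/LT ->] := eqVneq l'.1 ord0.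
Qed.

Lemma card_leaders_proper p : p \in proper_part [set: signed_partition n] ->
  (0 < #|leaders p| < n)%N.
Proof.
rewrite !inE /= => /andP[nmin nmax]; apply/andP; split.
  rewrite lt0n; apply: contra nmax; rewrite cards_eq0 => /eqP L0.
  by apply/forallP => q; rewrite inE /=; apply: leaders_set0_max.
rewrite ltnNge; apply: contra nmin => Ln.
apply/forallP => q; rewrite inE /=; apply: leaders_setT_min => a a0.
have /eqP -> : leaders p == [set~ ord0].
  rewrite eqEcard cardsC1 card_ord Ln andbT.
  by apply/subsetP => b /leaders_neq0; rewrite !inE.
by rewrite !inE.
Qed.

Lemma sorted_nth_lt x0 (s : seq (signed_partition n)) i j :
  sorted <%O s -> (i < j < size s)%N -> (nth x0 s i < nth x0 s j)%O.
Proof.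
move=> ss /andP[ij js].
by rewrite (lt_sorted_ltn_nth x0 ss) // inE; apply: ltn_trans js.
Qed.

Lemma leaders_sorted x0 (s : seq (signed_partition n)) i d :
  sorted <%O s -> (i + d < size s)%N ->
  (#|leaders (nth x0 s (i + d))| + d <= #|leaders (nth x0 s i)|)%N.
Proof.
move=> ss; elim: d => [|d IH] h; first by rewrite !addn0.
have lt : (nth x0 s (i + d) < nth x0 s (i + d.+1))%O.
  by apply: sorted_nth_lt => //; rewrite h addnS ltnS leqnn.
by have := leaders_lt lt; have := IH ltac:(lia); lia.
Qed.

(** The number of leaders drops at every step of a chain and lies strictly between 0 and n on proper
    elements. *)
Lemma no_long_simplex k (t : k.-tuple (signed_partition n)) :
  (0 < n)%N -> (n <= k)%N ->
  is_simplex (proper_part [set: signed_partition n]) t = false.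
Proof.
move=> n0 nk; apply/negP => /andP[st /allP At].
have k0 : (0 < k)%N by lia.
pose x0 := tnth t (Ordinal k0).
have h i : (i < k)%N -> (0 < #|leaders (nth x0 t i)| < n)%N.
  by move=> ik; apply: card_leaders_proper; apply: At; apply: mem_nth; rewrite size_tuple.
have := @leaders_sorted x0 t 0 k.-1 st; rewrite size_tuple add0n.
have := h 0%N k0; have := h k.-1 ltac:(lia); lia.
Qed.
End Leaders.

Lemma card_ord_ge N j : #|[set a : 'I_N | (j <= a)%N]| = (N - j)%N.
Proof.
rewrite -sum1dep_card -(big_mkord (fun i => j <= i)%N (fun=> 1%N)).
by rewrite -(big_nat_widenl j 0 N xpredT) // sum_nat_const_nat muln1.
Qed.

(** * Faces and links of top simplices *)

Section TopSimplex.
Variable m : nat.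
Local Notation n := m.+1.
Local Notation PP := (proper_part [set: signed_partition n]).
Implicit Types (t : m.-tuple (signed_partition n)).

(** The [m] entries have strictly decreasing numbers of leaders between 1 and [m], which leaves no
    choice. *)
Lemma card_leaders_simplex x0 t i : is_simplex PP t -> (i < m)%N ->
  #|leaders (nth x0 t i)| = (m - i)%N.
Proof.
move=> /andP[st /allP At] im.
have h j : (j < m)%N -> (0 < #|leaders (nth x0 t j)| < n)%N.
  by move=> jm; apply: card_leaders_proper; apply: At; apply: mem_nth; rewrite size_tuple.
have h1 := @leaders_sorted _ x0 t 0 i st; rewrite size_tuple add0n in h1.
have h2 := @leaders_sorted _ x0 t i (m - i).-1 st; rewrite size_tuple in h2.
have := h 0%N ltac:(lia).
have := h (i + (m - i).-1)%N ltac:(lia); have := h1 im; have := h2 ltac:(lia); lia.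
Qed.

Lemma face_eqP t t' (i : 'I_m) x0 : reflect
  (forall j, (j < m)%N -> j != i -> nth x0 t j = nth x0 t' j)
  (face i t == face i t').
Proof.
apply: (iffP eqP) => [E j jm ji|E].
  have ji' : i != Ordinal jm by rewrite eq_sym.
  have [j' Ej] := unlift_some ji'.
  move/(congr1 (fun u => tnth u j')): E; rewrite !tnth_mktuple -Ej.
  by rewrite !(tnth_nth x0).
apply: eq_from_tnth => j; rewrite !tnth_mktuple !(tnth_nth x0); apply: E => //.
by rewrite eq_sym neq_lift.
Qed.

(** The numbers of leaders in a face show which one is missing, hence which entry was deleted. *)
Lemma face_simplex_inj t t' (i j : 'I_m) :
  is_simplex PP t -> is_simplex PP t' -> face i t = face j t' -> i = j.
Proof.
wlog ij : i j t t' / (i < j)%N => [wl st st' E|].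
  case: (ltngtP i j) => [ij|ji|/val_inj //]; first exact: (wl _ _ _ _ ij st st').
  by apply/esym/(wl _ _ _ _ ji st' st); rewrite E.
move=> st st' E; have im : (i < m.-1)%N by have := ltn_ord j; lia.
have := congr1 (fun u => #|leaders (tnth u (Ordinal im))|) E.
move: (tnth t i) => x0; rewrite !tnth_mktuple !(tnth_nth x0).
rewrite !card_leaders_simplex ?ltn_ord //=.
by rewrite /bump leqnn leqNgt ij /=; have := ltn_ord j; lia.
Qed.

(** The coefficient of the boundary at [face i t] receives contributions through the index [i] only,
    all with the same sign. *)
Lemma cycle_link (c : {ffun m.-tuple (signed_partition n) -> int}) t (i : 'I_m) :
  c \in cycles PP m -> is_simplex PP t ->
  \sum_(t' | face i t' == face i t) c t' = 0.
Proof.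
move=> /andP[/forallP ch /eqP/ffunP/(_ (face i t))]; rewrite !ffunE => E st.
have {E} : (-1) ^+ i * \sum_(t' | face i t' == face i t) c t' = 0.
  rewrite -[RHS]E mulr_sumr big_mkcond; apply: eq_bigr => t' _.
  have [ct0|ct0] := eqVneq (c t') 0.
    rewrite ct0 mulr0 if_same big1 // => j _; exact: mulr0.
  have st' := implyP (ch t') ct0.
  rewrite [RHS](eq_bigl (fun j => (j == i) && (face i t' == face i t))).
    by rewrite big_mkcondr big_pred1_eq.
  move=> j; apply/eqP/andP => [F|[/eqP -> /eqP //]].
  by have ji := face_simplex_inj st' st F; rewrite -F -ji.
by move/eqP; rewrite mulf_eq0 signr_eq0 => /eqP.
Qed.

(* All of [y] but the block of the letter [k.+1] is determined by a common upper
   bound, whose contribution is abstracted in the last hypothesis. *)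
Lemma isolated_unique_le k (a0 : 'I_n.+1) (y y' : signed_partition n) :
  a0 = k.+1 :> nat ->
  (forall l, exists r, [/\ high k r, eqv y l r & eqv y' l r]) ->
  a0 \in leaders y -> a0 \in leaders y' ->
  (forall r s r' s', eqv y r s -> eqv y' r r' -> eqv y' s s' ->
     is_rep y' r' -> is_rep y' s' -> r'.1 != a0 -> s'.1 != a0 -> same r' s') ->
  (y <= y')%O.
Proof.
move=> a0k H Ly Ly' Hq; apply/eqv_leP => l l' ell'.
have [r [hr yr y'r]] := H l; have [s [hs ys y's]] := H l'.
have yrs : eqv y r s.
  by rewrite eqv_sym in yr; apply: eqv_trans yr (eqv_trans ell' ys).
apply: eqv_trans y'r _; rewrite eqv_sym; apply: eqv_trans y's _; rewrite eqv_sym.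
(* Under [y], the letter [a0] is alone among the letters high for [k]: a leader is not equivalent to
   0 or to larger letters, nor to its own negative, which would put it in the class of 0. *)
have iso u v : u.1 = a0 -> high k v -> eqv y u v -> u = v.
  case: u v => [a e] [b f] /= -> {a} hv.
  have [hb|hb] := boolP (high a0 (b, f)); first by rewrite leaders_eqvF.
  have b_a0 : b = a0.
    by apply: val_inj; move: hb hv; rewrite /high /= negb_or => /andP[/negbTE ->] /=; lia.
  rewrite b_a0; case: (eqVneq e f) => [->//|ef].
  have -> : (a0, f) = neg (a0, e) by case: e f ef {hv hb} => -[].
  by move/(eqv_neg0 false); rewrite leaders_eqvF // /high eqxx.
have [r1|r1] := eqVneq r.1 a0; first by rewrite (iso r s r1 hs yrs) eqv_refl.
have [s1|s1] := eqVneq s.1 a0.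
  by rewrite eqv_sym in yrs; rewrite (iso s r s1 hr yrs) eqv_refl.
have hi u : u.1 != a0 -> high k u -> high a0 u.
  rewrite /high => u1 /orP[->//|ku]; apply/orP; right.
  by rewrite ltn_neqAle a0k ku -a0k eq_sym val_eqE u1.
have [r' er' rr'] := ex_rep y' r; have [s' es' rs'] := ex_rep y' s.
have na u u' : u.1 != a0 -> high k u -> eqv y' u u' -> u'.1 != a0.
  move=> u1 hu; apply: contraTneq => u'1; case: u' u'1 => b f /= ->.
  by rewrite eqv_sym leaders_eqvF // hi.
apply: (eqv_trans er'); rewrite eqv_sym; apply: (eqv_trans es'); rewrite eqv_sym.
by apply/eqv_same/(Hq r s) => //; [apply: na er' | apply: na es'].
Qed.

(* The entry of index [i] of a top simplex is the partition x_(i+1). *)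
Definition typed k t := forall x0 i, (i < k)%N -> (i < m)%N ->
  leaders (nth x0 t i) = [set a : 'I_n.+1 | (i.+1 < a)%N].

(** Downward induction on the number [K] of typed initial entries. Link relations lower the index
    from which the letter [K + 1] is no longer a leader; once this index is [K], the chain is typed
    one entry further. *)
Lemma cycle_vanish (c : {ffun m.-tuple (signed_partition n) -> int}) :
  c \in cycles PP m -> (forall t, is_simplex PP t -> typed m t -> c t = 0) ->
  c = 0.
Proof.
move=> cZ Hm; have ch : forall t, c t != 0 -> is_simplex PP t.
  by move=> t; case/andP: cZ => /forallP/(_ t)/implyP h _; apply: h.
suff Q k : (k <= m)%N -> forall t, is_simplex PP t -> typed (m - k) t -> c t = 0.
  apply/ffunP => t; rewrite ffunE; have [//|/ch st] := eqVneq (c t) 0.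
  by apply: (Q m) => //; rewrite subnn => x0 i.
elim: k => [|k IHk] km t0 st0; first by rewrite subn0; apply: Hm.
have k_lt : (m - k.+1 < m)%N by lia.
pose x0 := tnth t0 (Ordinal k_lt).
have EK : (m - k = (m - k.+1).+1)%N by lia.
rewrite EK in IHk; move: (m - k.+1)%N k_lt @x0 EK IHk => K Km x0 _ IHk.
have {}IHk := IHk ltac:(lia).
pose a0 : 'I_n.+1 := inord K.+1.
have a0K : a0 = K.+1 :> nat by rewrite inordK //; lia.
have below t : is_simplex PP t -> forall i j, (i < j)%N -> (j < m)%N ->
    (nth x0 t i <= nth x0 t j)%O.
  move=> /andP[st _] i j ij jm; apply: ltW.
  by apply: sorted_nth_lt => //; rewrite size_tuple ij.
have Lsub t : is_simplex PP t -> typed K t -> forall i, (K <= i < m)%N ->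
    leaders (nth x0 t i) \subset [set a : 'I_n.+1 | (K < a)%N].
  move=> st tt i /andP[Ki im]; case: (posnP K) => [K0|K0].
    by apply/subsetP => a /leaders_neq0; rewrite inE K0 lt0n.
  have := leaders_le (below t st K.-1 i ltac:(lia) im).
  by rewrite (tt x0 K.-1) ?prednK //; lia.
(* For [K + d = m] there is no entry of index [K + d] and the condition on [a0] is void. *)
have step : forall d, (K + d <= m)%N -> forall t, is_simplex PP t -> typed K t ->
    ((K + d < m)%N -> a0 \notin leaders (nth x0 t (K + d))) -> c t = 0.
  elim=> [|d IHd] dm t st tt Ha.
    rewrite addn0 in dm Ha; apply: IHk => // y0 j jK jm.
    case: (ltngtP j K) => jK'; [exact: tt | lia | subst j].
    have LE : leaders (nth x0 t K) = [set a : 'I_n.+1 | (K.+1 < a)%N].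
      apply/eqP; rewrite eqEcard; apply/andP; split.
        apply/subsetP => a aL; have := subsetP (Lsub t st tt K ltac:(lia)) a aL.
        rewrite !inE leq_eqVlt => /orP[/eqP Ka|//].
        by have := Ha Km; rewrite (_ : a0 = a) ?aL //; apply: val_inj; rewrite /= a0K.
      by rewrite card_leaders_simplex // (card_ord_ge n.+1 K.+2); lia.
    by rewrite (set_nth_default x0) ?size_tuple.
  have im : (K + d < m)%N by lia.
  pose i := Ordinal im.
  have [a0L|] := boolP (a0 \in leaders (nth x0 t (K + d))); last first.
    by move=> h; apply: (IHd (ltnW im) t).
  (* In this link, a chain whose entry of index [K + d] does not have [a0] as a leader has value 0
     by induction; any other chain with nonzero value is shown to be [t]. *)
  have := cycle_link i cZ st; rewrite (bigD1 t) //= big1 ?addr0 // => t' /andP[/face_eqP Et' ntt'].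
  apply/eqP; apply: contraNT ntt' => ct'; have st' := ch _ ct'.
  have {}Et' := Et' x0.
  have tt' : typed K t'.
    move=> y0 j jK jm; rewrite (set_nth_default x0) ?size_tuple // Et' ?(tt x0) //.
    by rewrite neq_ltn /=; lia.
  have [a0L'|h] := boolP (a0 \in leaders (nth x0 t' (K + d))); last first.
    by rewrite (IHd (ltnW im) t') ?eqxx in ct'.
  set y := nth x0 t (K + d) in a0L; set y' := nth x0 t' (K + d) in a0L'.
  suff yy' : y' = y.
    apply/eqP/eq_from_tnth => j; rewrite !(tnth_nth x0).
    by have [-> //|ji] := eqVneq (val j) (K + d)%N; apply: Et'.
  pose q := nth x0 t (K + d.+1).
  have qE : (K + d.+1 < m)%N -> nth x0 t' (K + d.+1) = q.
    by move=> h; apply: Et' => //=; rewrite neq_ltn addnS ltnSn orbT.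
  (* [z] has exactly one leader more than [q], and [a0] is not a leader of [q]. At the end of the
     chain the maximum, which has no leaders, takes the place of [q]. *)
  have Cz z t1 : is_simplex PP t1 -> a0 \in leaders z -> z = nth x0 t1 (K + d) ->
      ((K + d.+1 < m)%N -> nth x0 t1 (K + d.+1) = q) ->
      ((K + d.+1 < m)%N -> (z <= q)%O) /\
      leaders z :\ a0 = if (K + d.+1 < m)%N then leaders q else set0.
    move=> st1 Lz zE qE1; have cz : #|leaders z :\ a0| = (m - (K + d)).-1.
      have := card_leaders_simplex x0 st1 im; rewrite -zE (cardsD1 a0) Lz => <-.
      by rewrite add1n.
    have zq : (K + d.+1 < m)%N -> (z <= q)%O.
      by move=> h; rewrite zE -(qE1 h); apply: below => //; rewrite addnS.
    split=> //; case: ifP => h; last first.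
      by apply/eqP; rewrite -cards_eq0 cz; move: dm h; clear; lia.
    apply/esym/eqP; rewrite eqEcard cz -{2}(qE1 h) card_leaders_simplex //.
    rewrite (_ : (_ <= _)%N = true) ?andbT; last by clear; lia.
    by rewrite subsetD1 leaders_le ?zq //=; apply: Ha.
  have Hy z z' t1 t2 : is_simplex PP t1 -> is_simplex PP t2 ->
      a0 \in leaders z -> a0 \in leaders z' -> typed K t1 ->
      (forall j, (j < K)%N -> nth x0 t1 j = nth x0 t2 j) ->
      z = nth x0 t1 (K + d) -> z' = nth x0 t2 (K + d) ->
      ((K + d.+1 < m)%N -> nth x0 t1 (K + d.+1) = q) ->
      ((K + d.+1 < m)%N -> nth x0 t2 (K + d.+1) = q) -> (z <= z')%O.
    move=> st1 st2 Lz Lz' tt1 E12 zE zE' qE1 qE2.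
    have [zq LE] := Cz z t1 st1 Lz zE qE1; have [zq' LE'] := Cz z' t2 st2 Lz' zE' qE2.
    apply: (isolated_unique_le a0K _ Lz Lz').
      move=> l; case: (posnP K) => [K0|K0].
        by exists l; rewrite !eqv_refl /high K0 lt0n orbN.
      (* The preceding entry is common to both chains and its leaders are the letters above [K], so
         it supplies a common high representative. *)
      have [r er rr] := ex_rep (nth x0 t1 K.-1) l; exists r; split.
      - by move: rr; rewrite /is_rep /high (tt1 x0 K.-1) ?inE ?prednK // ltnW.
      - by apply: eqv_le er; rewrite zE; apply: below => //; apply: ltn_addr; rewrite prednK.
      - by apply: eqv_le er; rewrite zE' E12 ?prednK //; apply: below => //;
          apply: ltn_addr; rewrite prednK.
    move=> r s r' s' ers er es rr' rs' r'a s'a.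
    have Lr u : is_rep z' u -> u.1 != a0 ->
        (u.1 == ord0) || (u.1 \in if (K + d.+1 < m)%N then leaders q else set0).
      by rewrite -LE' /is_rep in_setD1 => /orP[->|->] // ->; rewrite orbT.
    move: (Lr _ rr' r'a) (Lr _ rs' s'a); case: ifP => h.
      move=> rq sq; apply: (rep_uniq rq sq).
      have er' : eqv q r' r by rewrite eqv_sym; apply: eqv_le er; apply: zq'.
      apply: eqv_trans er' (eqv_trans (eqv_le (zq h) ers) _).
      by apply: eqv_le es; apply: zq'.
    by rewrite !inE !orbF /same => /eqP -> /eqP ->.
  have E12 j : (j < K)%N -> nth x0 t' j = nth x0 t j.
    by move=> jK; apply: Et' => /=; move: jK (im); clear; lia.
  apply: le_anti; apply/andP; split.
    by apply: (Hy _ _ t' t).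
  by apply: (Hy _ _ t t') => // j jK; rewrite E12.
by move=> tt; apply: (step (m - K)%N) => //; rewrite subnKC ?ltnn // ltnW.
Qed.
End TopSimplex.

(** * Positions and splittings *)

(** Position in the symmetric word -w(n), ..., -w(1), 0, w(1), ..., w(n), centred at 0. *)
Definition pos n (w : signed_perm n) (l : letter n) : int :=
  if unlift ord0 l.1 is Some a then
    let i := (w.1^-1)%g a in
    if l.2 == w.2 i then (i.+1)%:Z else - (i.+1)%:Z
  else 0.

Definition at_pos n (w : signed_perm n) (j : nat) : letter n :=
  if j is i.+1 then
    if insub i is Some a then (lift ord0 (w.1 a), w.2 a) else (ord0, false)
  else (ord0, false).

Section Positions.
Variables (n : nat) (w : signed_perm n).
Implicit Types (l : letter n) (S : {set 'I_n}).

Lemma pos0 e : pos w (ord0, e) = 0.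
Proof. by rewrite /pos unlift_none. Qed.

Lemma posE i e : pos w (lift ord0 (w.1 i), e) =
  if e == w.2 i then (i.+1)%:Z else - (i.+1)%:Z.
Proof. by rewrite /pos liftK permK. Qed.

Variant letter_spec : letter n -> Type :=
  | Letter0 e : letter_spec (ord0, e)
  | LetterS i e : letter_spec (lift ord0 (w.1 i), e).

Lemma letterP l : letter_spec l.
Proof.
case: l => a e; case: (unliftP ord0 a) => [b|] ->; last exact: Letter0.
by rewrite -(permKV w.1 b); apply: LetterS.
Qed.

Lemma pos_neg l : pos w (neg l) = - pos w l.
Proof.
case: (letterP l) => [e|i e]; first by rewrite /neg !pos0 oppr0.
by rewrite /neg !posE /=; case: e (w.2 i) => -[]; rewrite /= ?opprK.
Qed.

Lemma pos_inj l l' : pos w l = pos w l' -> same l l'.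
Proof.
case: (letterP l) => [e|i e]; case: (letterP l') => [f|j f]; rewrite ?pos0 ?posE.
- by rewrite /same !eqxx.
- by case: ifP => _ ?; exfalso; lia.
- by case: ifP => _ ?; exfalso; lia.
move=> E; have ij : i = j by apply: val_inj => /=; move: E; do 2 case: ifP => _; lia.
move: E; rewrite -ij /same /= eqxx.
by case: e f (w.2 i) => -[] -[] //= ?; exfalso; lia.
Qed.

Lemma pos_bound l : (- n%:Z <= pos w l <= n%:Z)%R.
Proof.
by case: (letterP l) => [e|i e]; rewrite ?pos0 ?posE; [|case: ifP => _; have := ltn_ord i]; lia.
Qed.

Lemma pos_at_pos j : (j <= n)%N -> pos w (at_pos w j) = j%:Z.
Proof.
case: j => [|j] jn; first by rewrite pos0.
by rewrite /at_pos insubT posE eqxx.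
Qed.

Lemma in_zero_pos S l : ((l.1, false) \in split_zero_block w S) <->
  (forall s, s \in S -> (pos w l <= s%:Z) && (- pos w l <= s%:Z)).
Proof.
split.
  case/in_split_zero_block => [[l0] s Ss|[i iS [lE]] s /iS si].
    by case: l l0 => a e /= ->; rewrite pos0; lia.
  by case: l lE => a e /= ->; rewrite posE; case: ifP => _; lia.
move=> H; apply/in_split_zero_block; case: (letterP l) H => [e|i e] H; first by left.
right; exists i => // s /H; rewrite posE; case: ifP => _; lia.
Qed.

Lemma in_segment_pos S s0 l : (l \in split_segment w S s0) <->
  (s0%:Z < pos w l /\ forall s, s \in S -> (s0 < s)%N -> pos w l <= s%:Z).
Proof.
split.
  case/in_split_segment => i [si iS ->]; rewrite posE eqxx; split; first lia.
  by move=> s Ss ss; have := iS _ Ss ss; lia.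
case: (letterP l) => [e|i e]; rewrite ?pos0 ?posE; first by case=> h; exfalso; lia.
case: eqP => [->|_] [h H]; last by exfalso; lia.
by apply/in_split_segment; exists i; split.
Qed.

(** Each [s] in [S] places a divider between positions s and s+1 and its mirror image between -s-1
    and -s. *)
Definition nosep S l l' := forall s, s \in S ->
  ((pos w l <= s%:Z) = (pos w l' <= s%:Z)) /\
  ((- pos w l <= s%:Z) = (- pos w l' <= s%:Z)).

Lemma zero_block_split S : zero_block (split_zero_block w S).
Proof. by apply: (@zero_block0 _ _ false); apply/in_split_zero_block; left. Qed.

Lemma zero_block_segment S s : zero_block (normalize_block (split_segment w S s)) = false.
Proof.
apply/negbTE/existsP => -[[a e] /andP[+ /eqP /= a0]]; rewrite {}a0.
have [f ->] := normalize_blockE (split_segment w S s).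
by move=> /in_segment_pos; rewrite pos0 => -[h]; exfalso; lia.
Qed.

(** The classes are the intervals between dividers; normalizing a block only exchanges a segment
    with its negative, which changes no class. *)
Lemma eqv_split S l l' : eqv (split_partition w S) l l' <-> nosep S l l'.
Proof.
have nz s0 c : c = normalize_block (split_segment w S s0) -> exists g : bool,
    forall x, (x \in c) = ((if g then neg x else x) \in split_segment w S s0).
  move=> ->; have [g gE] := normalize_blockE (split_segment w S s0).
  by exists g => -[a e]; rewrite gE; case: g {gE}; rewrite ?addbT ?addbF.
split.
  case/eqvP => c /setU1P[->|/imsetP[s0 Ss0 cE]]; rewrite /eqv_in.
    rewrite zero_block_split => /andP[/in_zero_pos H /in_zero_pos H'] s Ss.
    by have := H s Ss; have := H' s Ss; lia.
  rewrite cE zero_block_segment -cE; have [g gE] := nz s0 c cE; rewrite !gE.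
  have main x x' : x \in split_segment w S s0 -> x' \in split_segment w S s0 ->
      nosep S x x'.
    move=> /in_segment_pos[h1 H1] /in_segment_pos[h2 H2] s Ss.
    case: (ltnP s0 s) => ss; last by split; lia.
    by have := H1 s Ss ss; have := H2 s Ss ss; split; lia.
  have nn x x' : nosep S (neg x) (neg x') -> nosep S x x'.
    by move=> H s /H; rewrite !pos_neg !opprK => -[].
  by case: g {gE}; rewrite ?negK => /orP[] /andP[h h'];
    first [exact: main | apply: nn; exact: main].
move=> H; apply/eqvP.
have [/forall_inP Z|] := boolP [forall s in S, (pos w l <= s%:Z) && (- pos w l <= s%:Z)].
  exists (split_zero_block w S); first by rewrite setU11.
  rewrite /eqv_in zero_block_split; apply/andP; split; apply/in_zero_pos => // s Ss.
  by have [<- <-] := H s Ss; apply: Z.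
rewrite negb_forall_in => /existsP[s1 /andP[Ss1 hs1]].
pose Q (s : 'I_n) := (s \in S) && ~~ ((pos w l <= s%:Z) && (- pos w l <= s%:Z)).
have Q1 : Q s1 by rewrite /Q Ss1.
(* [s0] is the last divider between 0 and [l] or its negative, hence the start of the segment
   sought. *)
case: (@arg_maxnP _ s1 Q (fun s => s : nat) Q1) => s0 /andP[Ss0 hs0] smax.
have lo s : s \in S -> (s0 < s)%N -> (pos w l <= s%:Z) && (- pos w l <= s%:Z).
  move=> Ss ss; apply: contraT => h.
  by have := smax s; rewrite /Q Ss h => /(_ isT) /=; lia.
pose c := normalize_block (split_segment w S s0).
exists c; first by apply/setU1P; right; apply: imset_f.
rewrite /eqv_in zero_block_segment; have [g gE] := nz s0 c erefl; rewrite !gE.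
have [h1 h2] := H s0 Ss0.
have main x x' : nosep S x x' -> s0%:Z < pos w x ->
    (forall s, s \in S -> (s0 < s)%N -> pos w x <= s%:Z) ->
    (x \in split_segment w S s0) && (x' \in split_segment w S s0).
  move=> Hx h hx; apply/andP; split; apply/in_segment_pos; split=> //.
    by have := Hx s0 Ss0; lia.
  by move=> s Ss ss; have := Hx s Ss; have := hx s Ss ss; lia.
have Hn : nosep S (neg l) (neg l').
  by move=> s /H; rewrite !pos_neg !opprK => -[].
have [pl|pl] := boolP (s0%:Z < pos w l).
  have M := main l l' H pl (fun s Ss ss => proj1 (andP (lo s Ss ss))).
  by case: g {gE}; rewrite ?negK M ?orbT.
have pn : s0%:Z < pos w (neg l).
  by rewrite pos_neg; move: hs0 pl; clear; lia.
have M : (neg l \in split_segment w S s0) && (neg l' \in split_segment w S s0).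
  by apply: main => // s Ss ss; rewrite pos_neg; case/andP: (lo s Ss ss).
by case: g {gE}; rewrite ?negK M ?orbT.
Qed.

Lemma split_convex p l1 l2 l3 : p \in split_poset w ->
  pos w l1 <= pos w l2 -> pos w l2 <= pos w l3 -> eqv p l1 l3 -> eqv p l1 l2.
Proof.
case/imsetP=> S _ -> h12 h23 /eqv_split H; apply/eqv_split => s /H; lia.
Qed.

Lemma eqv_split_step S (s : 'I_n) :
  eqv (split_partition w S) (at_pos w s) (at_pos w s.+1) = (s \notin S).
Proof.
have ps : pos w (at_pos w s) = s%:Z by apply/pos_at_pos/ltnW.
have ps1 : pos w (at_pos w s.+1) = s.+1%:Z by apply: pos_at_pos.
apply/idP/idP => [/eqv_split H|nS].
  by apply/negP => /H; rewrite ps ps1; lia.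
apply/eqv_split => s' Ss'; rewrite ps ps1.
have : s != s' by apply: contraNneq nS => ->.
by rewrite -val_eqE /= => ?; lia.
Qed.

Lemma split_partition_inj : injective (split_partition w).
Proof.
move=> S S' E; apply/setP => s; apply: negb_inj.
by rewrite -!eqv_split_step E.
Qed.

Lemma split_partition_le S S' :
  S' \subset S -> (split_partition w S <= split_partition w S')%O.
Proof.
move=> /subsetP sS; apply/eqv_leP => l l' /eqv_split H.
by apply/eqv_split => s /sS/H.
Qed.
End Positions.

(** * Codes *)

Definition sg (b : bool) (x : int) : int := if b then - x else x.

(* [m] is fuel: the letters met along [v] increase, so n.+1 steps suffice. *)
Fixpoint code_val n (v : 'I_n.+1 -> letter n) (k m : nat) (a : 'I_n.+1) : int :=
  if m is m'.+1 then
    if a == ord0 then 0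
    else (if (k < a)%N then (3 ^ a)%N%:Z else 0) +
         sg (v a).2 (code_val v k m' (v a).1)
  else 0.

(* Digits 3^a with a <= k are dropped: [cpos v k l] is [cpos v 0 l] rounded to
   the nearest multiple of 3^(k+1). *)
Definition cpos n (v : 'I_n.+1 -> letter n) (k : nat) (l : letter n) : int :=
  sg l.2 (code_val v k n.+1 l.1).

Definition is_code n (v : 'I_n.+1 -> letter n) := forall a, a != ord0 -> high a (v a).

Section Codes.
Variables (n : nat) (v : 'I_n.+1 -> letter n).
Hypothesis Hv : is_code v.
Implicit Types (l r : letter n) (a b : 'I_n.+1).

Lemma cpos_neg k l : cpos v k (neg l) = - cpos v k l.
Proof. by rewrite /cpos /= /sg; case: l.2; rewrite /= ?opprK. Qed.

Lemma cpos_0 k e : cpos v k (ord0, e) = 0.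
Proof. by rewrite /cpos /= /sg; case: e; rewrite ?oppr0. Qed.

Lemma cpos_same k l l' : same l l' -> cpos v k l = cpos v k l'.
Proof.
case: l l' => [a e] [a' e'] /andP[/= /eqP <- /orP[/eqP ->|/eqP <-]] //.
by rewrite !cpos_0.
Qed.

Lemma code_val0 k m : code_val v k m ord0 = 0.
Proof. by case: m. Qed.

Lemma code_val_stable k m m' a : (n - a < m)%N -> (n - a < m')%N ->
  code_val v k m a = code_val v k m' a.
Proof.
elim: m m' a => // m IH [|m'] a //= h h'; case: eqP => // /eqP a0.
congr (_ + sg _ _); have := Hv a0; rewrite /high => /orP[/eqP ->|va].
  by rewrite !code_val0.
by apply: IH; have := ltn_ord (v a).1; lia.
Qed.

Lemma cposE k a : a != ord0 ->
  cpos v k (a, false) = (if (k < a)%N then (3 ^ a)%N%:Z else 0) + cpos v k (v a).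
Proof.
move=> a0; rewrite {1}/cpos [LHS]/= (negbTE a0) /cpos; congr (_ + sg _ _).
have := Hv a0; rewrite /high => /orP[/eqP ->|va].
  by rewrite !code_val0.
by apply: code_val_stable; have := ltn_ord (v a).1; lia.
Qed.

Lemma cposE0 a : a != ord0 -> cpos v 0 (a, false) = (3 ^ a)%N%:Z + cpos v 0 (v a).
Proof. by move=> a0; rewrite cposE // lt0n [X in if X then _ else _]a0. Qed.

(** Iterating [v] climbs to ever larger letters and ends at 0; negation handles the barred
    letters. *)
Lemma code_ind (Q : letter n -> Prop) : (forall e, Q (ord0, e)) ->
  (forall l, Q l -> Q (neg l)) -> (forall a, a != ord0 -> Q (v a) -> Q (a, false)) ->
  forall l, Q l.
Proof.
move=> Q0 Qn QS l; have [N] := ubnP (n - l.1)%N; elim: N l => // N IH [a e] /= aN.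
suff Qa : Q (a, false) by case: e; [apply: (Qn (a, false)) |].
have [->|a0] := eqVneq a ord0; first exact: Q0.
apply: QS => //; have := Hv a0; rewrite /high => /orP[/eqP va|va].
  by rewrite (surjective_pairing (v a)) va.
by apply: IH; have := ltn_ord (v a).1; lia.
Qed.

Lemma exp3_gt j a : (j < a)%N -> exists z : int, (3 ^ a)%N%:Z = (3 ^ j.+1)%N%:Z * z.
Proof.
move=> ja; exists (3 ^ (a - j.+1))%N%:Z; rewrite -PoszM -expnD; congr (Posz (3 ^ _)); lia.
Qed.

Lemma cpos_dvd k l : exists z, cpos v k l = (3 ^ k.+1)%N%:Z * z.
Proof.
elim/code_ind: l => [e|l [z E]|a a0 [z E]].
- by exists 0; rewrite cpos_0 mulr0.
- by exists (- z); rewrite cpos_neg E mulrN.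
rewrite cposE // E; case: ifP => [/exp3_gt[y ->]|_]; last by exists z; rewrite add0r.
by exists (y + z); rewrite mulrDr.
Qed.

Lemma cpos_dvd_high k j l : high j l -> exists z, cpos v k l = (3 ^ j.+1)%N%:Z * z.
Proof.
elim/code_ind: l => [e _|l IH /IH[z E]|a a0 IH ja].
- by exists 0; rewrite cpos_0 mulr0.
- by exists (- z); rewrite cpos_neg E mulrN.
rewrite /high /= (negbTE a0) /= in ja; rewrite cposE //.
have [|z E] := IH.
  have := Hv a0; rewrite /high => /orP[->//|va]; apply/orP; right; exact: ltn_trans va.
rewrite E; case: ifP => _; last by exists z; rewrite add0r.
by have [y ->] := exp3_gt ja; exists (y + z); rewrite mulrDr.
Qed.

Lemma cpos_high j k l : (j <= k)%N -> high k l -> cpos v j l = cpos v k l.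
Proof.
move=> jk; elim/code_ind: l => [e|l IH h|a a0 IH]; rewrite ?cpos_0 //.
  by rewrite !cpos_neg IH.
rewrite /high /= (negbTE a0) /= => ka; rewrite !cposE // ka (leq_ltn_trans jk ka) IH //.
have := Hv a0; rewrite /high => /orP[->//|va]; apply/orP; right; exact: ltn_trans va.
Qed.

(** The dropped digits are, up to sign, distinct powers 3^b with [l.1] <= b <= k, and the geometric
    sum bounds twice their total by 3^(k+1) - 3^([l.1]). *)
Lemma cpos_low j k l : (j <= k)%N -> ~~ high k l ->
  2 * `|cpos v j l - cpos v k l| + (3 ^ l.1)%N%:Z <= (3 ^ k.+1)%N%:Z.
Proof.
move=> jk; elim/code_ind: l => [e|l IH h|a a0 IH]; first by rewrite /high eqxx.
  by have := IH h; rewrite !cpos_neg /=; lia.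
rewrite /high /= (negbTE a0) /= -leqNgt => ak; rewrite !cposE //.
have -> : (k < a)%N = false by lia.
have e3 : (3 ^ a.+1 <= 3 ^ k.+1)%N by rewrite leq_pexp2l.
rewrite expnS in e3.
have [hv|hv] := boolP (high k (v a)).
  by rewrite (cpos_high jk hv); case: ifP => _; lia.
have := IH hv; have va : (a < (v a).1)%N.
  have := Hv a0; move: hv; rewrite /high negb_or => /andP[/negbTE -> _] //.
have : (3 ^ a.+1 <= 3 ^ (v a).1)%N by rewrite leq_pexp2l.
by rewrite expnS; case: ifP => _; lia.
Qed.

Lemma cpos_bound j k l : (j <= k)%N ->
  2 * `|cpos v j l - cpos v k l| < (3 ^ k.+1)%N%:Z.
Proof.
move=> jk; have := expn_gt0 3 k.+1; have [h|h] := boolP (high k l).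
  by rewrite (cpos_high jk h); lia.
by have := cpos_low jk h; have := expn_gt0 3 l.1; lia.
Qed.

(** By [cpos_bound] the value at level [k] is the nearest multiple of 3^(k+1), without ties, and
    such rounding preserves order. *)
Lemma cpos_mono j k l l' : (j <= k)%N -> cpos v j l <= cpos v j l' -> cpos v k l <= cpos v k l'.
Proof.
move=> jk h; have := cpos_bound l jk; have := cpos_bound l' jk.
have [z E] := cpos_dvd k l; have [z' E'] := cpos_dvd k l'.
rewrite E E'; move: (3 ^ k.+1)%N => M h1 h2.
have [//|zz] := leP (M%:Z * z) (M%:Z * z').
have M0 : 0 < M%:Z by lia.
have {zz} zz : z' + 1 <= z by rewrite (ltr_pM2l M0) in zz; lia.
have : M%:Z * (z' + 1) <= M%:Z * z by rewrite (ler_pM2l M0).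
by rewrite mulrDr mulr1; lia.
Qed.

Lemma cpos_eq_mono j k l l' : (j <= k)%N -> cpos v j l = cpos v j l' -> cpos v k l = cpos v k l'.
Proof. by move=> jk E; apply: le_anti; rewrite !(cpos_mono jk) // E. Qed.

Lemma cpos_shape a : a != ord0 -> exists z,
  cpos v 0 (a, false) = (3 ^ a)%N%:Z * (1 + 3 * z).
Proof.
move=> a0; rewrite cposE0 //.
have [z ->] := cpos_dvd_high 0 (Hv a0); exists z.
by rewrite expnS mulnC PoszM mulrDr mulr1 mulrA.
Qed.

Lemma cpos_neq a e l : a != ord0 -> high a l -> cpos v 0 (a, e) != cpos v 0 l.
Proof.
move=> a0 hl; have [z E] := cpos_shape a0; have [y E'] := cpos_dvd_high 0 hl.
have -> : cpos v 0 (a, e) = (3 ^ a)%N%:Z * (if e then - (1 + 3 * z) else 1 + 3 * z).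
  by case: e; rewrite ?mulrN -E //; exact: (cpos_neg 0 (a, false)).
rewrite E' expnS mulnC PoszM -mulrA; apply/eqP => /mulfI.
have -> : (3 ^ a)%N%:Z != 0 by have := expn_gt0 3 a; lia.
by move/(_ isT); case: e; lia.
Qed.

(** The exact power of 3 dividing a nonzero position tells the letter; the sign is told because a
    nonzero position differs from its negative. *)
Lemma cpos_inj l l' : cpos v 0 l = cpos v 0 l' -> same l l'.
Proof.
case: l l' => [a e] [b f] E; rewrite /same /=.
have [a0|a0] := eqVneq a ord0.
  have [b0|b0] := eqVneq b ord0; first by rewrite a0 b0 eqxx.
  by have := @cpos_neq b f (a, e) b0; rewrite /high a0 eqxx -E a0 eqxx => /(_ isT).
have [b0|b0] := eqVneq b ord0.
  by have := @cpos_neq a e (b, f) a0; rewrite /high b0 eqxx E b0 eqxx => /(_ isT).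
case: (ltngtP a b) => ab.
- by have := @cpos_neq a e (b, f) a0; rewrite /high /= ab orbT E eqxx => /(_ isT).
- by have := @cpos_neq b f (a, e) b0; rewrite /high /= ab orbT E eqxx => /(_ isT).
move/val_inj: ab E => <-; rewrite eqxx /=.
case: e f => -[] // E; exfalso.
  have := @cpos_neq a false (ord0, false) a0; rewrite /high eqxx cpos_0 => /(_ isT).
  by have := cpos_neg 0 (a, false); rewrite /neg /= E; lia.
have := @cpos_neq a false (ord0, false) a0; rewrite /high eqxx cpos_0 => /(_ isT).
by have := cpos_neg 0 (a, false); rewrite /neg /= -E; lia.
Qed.

Lemma cpos_gap k l l' : high k l -> high k l' -> cpos v 0 l < cpos v 0 l' ->
  cpos v 0 l + (3 ^ k.+1)%N%:Z <= cpos v 0 l'.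
Proof.
move=> h h'; have [z ->] := cpos_dvd_high 0 h; have [z' ->] := cpos_dvd_high 0 h'.
have M0 : 0 < (3 ^ k.+1)%N%:Z by have := expn_gt0 3 k.+1; lia.
move: (3 ^ k.+1)%N%:Z M0 => M M0; rewrite (ltr_pM2l M0) => zz.
rewrite -{2}[M]mulr1 -mulrDr (ler_pM2l M0); lia.
Qed.

End Codes.

(** * Codes and signed permutations *)

Definition codes n (v : 'I_n.+1 -> letter n) (w : signed_perm n) :=
  forall l l', (cpos v 0 l < cpos v 0 l') = (pos w l < pos w l').

Section CodePerm.
Variable n : nat.
Implicit Types (v : 'I_n.+1 -> letter n) (w : signed_perm n) (l r : letter n).

Lemma rank_perm (g : 'I_n -> nat) : injective g -> exists s : 'S_n,
  forall a b, (s a < s b)%N = (g a < g b)%N.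
Proof.
move=> g_inj; pose A a := [set b | (g b < g a)%N].
have ltA a : (#|A a| < n)%N.
  rewrite -[X in (_ < X)%N]card_ord -cardsT; apply: proper_card.
  by rewrite properT; apply/eqP => /setP/(_ a); rewrite !inE ltnn.
have mono a b : (g a < g b)%N -> (#|A a| < #|A b|)%N.
  move=> ab; apply: proper_card; apply/properP; split.
    by apply/subsetP => c; rewrite !inE => /ltn_trans; apply.
  by exists a; rewrite !inE ?ltnn.
pose f a := Ordinal (ltA a).
have f_inj : injective f.
  move=> a b /(congr1 val) /= E; apply: g_inj.
  by case: (ltngtP (g a) (g b)) => // /mono; rewrite E ltnn.
exists (perm f_inj) => a b; rewrite !permE /=.
case: (ltngtP (g a) (g b)) => [/mono -> //|/mono|/g_inj ->]; last by rewrite ltnn.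
by move=> h; apply/negbTE; rewrite -leqNgt ltnW.
Qed.

Lemma codes_le v w l l' : codes v w -> (cpos v 0 l <= cpos v 0 l') = (pos w l <= pos w l').
Proof. by move=> M; rewrite !leNgt M. Qed.

(** The word lists the letters by increasing absolute position and bars those whose unbarred form
    has a negative position. *)
Lemma code_perm v : is_code v -> exists w, codes v w.
Proof.
move=> Hv; pose Pa (a : 'I_n) := cpos v 0 (lift ord0 a, false).
have Pa0 a : Pa a != 0 by rewrite -(cpos_0 v 0 false); apply: cpos_neq.
have g_inj : injective (fun a => absz (Pa a)).
  move=> a b E; have : exists e, cpos v 0 (lift ord0 a, false) = cpos v 0 (lift ord0 b, e).
    have [Eab|Eab] := eqVneq (Pa a) (Pa b); [by exists false | exists true].
    by have := cpos_neg v 0 (lift ord0 b, false); rewrite /neg /= -/(Pa a) -/(Pa b); lia.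
  by case=> e /(cpos_inj Hv) /andP[/= /eqP /lift_inj].
have [s sE] := rank_perm g_inj.
pose w : signed_perm n := ((s^-1)%g, [ffun i => Pa ((s^-1)%g i) < 0]).
exists w => l l'.
have posP l0 : (l0.1 = ord0 /\ (cpos v 0 l0 = 0 /\ pos w l0 = 0)) \/
    (exists a (e : bool), cpos v 0 l0 = (if e then - (absz (Pa a))%:Z else (absz (Pa a))%:Z) /\
       pos w l0 = (if e then - (s a).+1%:Z else (s a).+1%:Z)).
  case: l0 => c e; case: (unliftP ord0 c) => [a|] -> /=; last first.
    by left; rewrite cpos_0 pos0.
  right; have wE : a = w.1 (s a) by rewrite /= permK.
  exists a, (e (+) (Pa a < 0)); rewrite [in pos _ _]wE posE ffunE /= permK.
  have -> : cpos v 0 (lift ord0 a, e) = if e then - Pa a else Pa a.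
    by case: e => //; apply: (cpos_neg v 0 (lift ord0 a, false)).
  by case: e; case: ltP (Pa0 a) => //=; lia.
case: (posP l) => [[_ [-> ->]]|[a [e [-> ->]]]];
case: (posP l') => [[_ [-> ->]]|[b [f [-> ->]]]] //.
- by have := Pa0 b; case: f; lia.
- by have := Pa0 a; case: e; lia.
have := sE a b; have := sE b a; have := Pa0 a; have := Pa0 b.
by case: e f => -[]; lia.
Qed.

(** [v a] lies to the left of [a]. If [a] is barred in the word, its unbarred form has a negative
    position, so [v a] is farther from 0 and exhibits a larger letter to the right of [a] in the
    word. *)
Lemma codes_good v w : is_code v -> codes v w -> rl_maxima_unbarred w.
Proof.
move=> Hv M; apply/forallP => i; apply/implyP => /forallP rl; apply/negP => wi.
pose a := lift ord0 (w.1 i); have a0 : a != ord0 by [].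
have pa : pos w (a, false) = - (i.+1)%:Z by rewrite posE wi.
have lt1 : cpos v 0 (v a) < cpos v 0 (a, false).
  by rewrite (cposE0 Hv a0); have := expn_gt0 3 a; lia.
have := Hv a a0; move: lt1; rewrite M pa; case: (letterP w (v a)) => [e|j e].
  by rewrite pos0; lia.
rewrite posE /high /= => h; have ij : (i < j)%N by move: h; case: ifP => _; lia.
by have := implyP (rl j) ij; rewrite /a /= /bump /=; lia.
Qed.

(** [v a] is chosen as the nearest letter to the left of [a] among 0 and the letters larger than
    [a]. *)
Lemma good_codes w : rl_maxima_unbarred w -> exists2 v, is_code v & codes v w.
Proof.
move=> /forallP good.
have cand a : a != ord0 -> exists l, high a l && (pos w l < pos w (a, false)).
  move=> a0; have [i aE] : exists i, a = lift ord0 (w.1 i).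
    by have := letterP w (a, false); case E : _ / => [e|i e]; case: E a0 => -> //; exists i.
  rewrite {}aE {a a0}; have [wi|wi] := boolP (w.2 i); last first.
    by exists (ord0, false); rewrite /high eqxx pos0 posE (negbTE wi) /=; lia.
  have := good i; rewrite wi implybF negb_forall => /existsP[j].
  rewrite negb_imply -leqNgt => /andP[ij wij].
  (* A barred letter is followed by a larger one; the sign opposite to that in the word puts it at a
     negative position, farther left. *)
  exists (lift ord0 (w.1 j), ~~ w.2 j); rewrite !posE wi /high /= /bump /=.
  have nij : w.1 i != w.1 j by apply: contraTneq ij => /perm_inj ->; rewrite ltnn.
  rewrite -val_eqE /= in nij.
  by case: (w.2 j) => /=; lia.
have vex a : exists l, a != ord0 -> [/\ high a l, pos w l < pos w (a, false) &
    forall l', high a l' -> pos w l' < pos w (a, false) -> pos w l' <= pos w l].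
  have [->|a0] := eqVneq a ord0; first by exists (ord0, false).
  have [l0 Q0] := cand a a0.
  pose Q (l : letter n) := high a l && (pos w l < pos w (a, false)).
  have [l /andP[h1 h2] h3] := @arg_maxP _ _ _ l0 Q (pos w) Q0.
  by exists l => _; split=> // l' h h'; apply: h3; rewrite /Q h.
have [v vP] := choice vex.
have Hv : is_code v by move=> a /vP[].
exists v => //.
(* Letters are inserted in decreasing order. Those already placed are at least 3^(a+1) apart, so
   [a], at distance 3^a to the right of [v a], falls before the next one. *)
suff H k : (k <= n)%N -> forall l l', high (n - k) l -> high (n - k) l' ->
    pos w l < pos w l' -> cpos v 0 l < cpos v 0 l'.
  have h0 l : high (n - n) l by rewrite /high subnn lt0n orbN.
  move=> l l'; case: (ltgtP (pos w l) (pos w l')) => E.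
  - by apply: (H n).
  - by have := H n (leqnn n) l' l (h0 _) (h0 _) E; lia.
  - by rewrite (cpos_same v 0 (pos_inj E)) ltxx.
elim: k => [|k IH] kn l l' hl hl'.
  have z r : high (n - 0) r -> r.1 = ord0.
    by rewrite /high subn0 => /orP[/eqP //|]; have := ltn_ord r.1; lia.
  case: l hl => a e /z /= ->; case: l' hl' => b f /z /= ->.
  by rewrite !pos0 ltxx.
have {}IH := IH (ltnW kn).
have EK : (n - k = (n - k.+1).+1)%N by lia.
move: (n - k.+1)%N EK IH hl hl' => K EK; rewrite EK => IH hl hl'.
pose a : 'I_n.+1 := inord K.+1.
have aK : a = K.+1 :> nat by rewrite inordK //; lia.
have a0 : a != ord0 by rewrite -val_eqE /= aK.
have hcase r : high K r -> high K.+1 r \/ exists e, r = (a, e).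
  case: r => b e; rewrite /high /= => /orP[->|]; first by left.
  rewrite leq_eqVlt => /orP[/eqP Kb|->]; last by left; rewrite orbT.
  by right; exists e; congr pair; apply: val_inj; rewrite /= aK.
have Pa : cpos v 0 (a, false) = (3 ^ K.+1)%N%:Z + cpos v 0 (v a).
  by rewrite (cposE0 Hv a0) aK.
have [vh vlt vmax] := vP a a0; rewrite aK in vh vmax.
have M0 := expn_gt0 3 K.+1.
have M1 : (3 ^ K.+2 = 3 * 3 ^ K.+1)%N by rewrite expnS.
have up r : high K.+1 r -> pos w (a, false) < pos w r -> cpos v 0 (a, false) < cpos v 0 r.
  move=> hr /(lt_trans vlt) /(IH _ _ vh hr) /(cpos_gap Hv vh hr); rewrite Pa; lia.
have dn r : high K.+1 r -> pos w r < pos w (a, false) -> cpos v 0 r < cpos v 0 (a, false).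
  move=> hr /(vmax _ hr); rewrite le_eqVlt => /orP[/eqP /pos_inj /(cpos_same v 0)|].
    by rewrite Pa => ->; lia.
  by move=> /(IH _ _ hr vh); rewrite Pa; lia.
have nt : (a, true) = neg (a, false) by [].
have hneg r : high K.+1 (neg r) = high K.+1 r by [].
have Pn r : cpos v 0 (neg r) = - cpos v 0 r by apply: cpos_neg.
have pn r : pos w (neg r) = - pos w r by apply: pos_neg.
case: (hcase _ hl) (hcase _ hl') => [h|[e ->]] [h'|[f ->]].
- exact: IH.
- case: f => pl; last exact: dn.
  have := up (neg l); rewrite hneg Pn pn nt Pn; move: pl; rewrite nt pn => pl.
  by move=> /(_ h ltac:(lia)); lia.
- case: e => pl; last exact: up.
  have := dn (neg l'); rewrite hneg Pn pn nt Pn; move: pl; rewrite nt pn => pl.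
  by move=> /(_ h' ltac:(lia)); lia.
have h0 : high K.+1 (ord0 : 'I_n.+1, false) by rewrite /high eqxx.
have := up _ h0; have := dn _ h0; rewrite cpos_0 pos0.
by case: e f => -[]; rewrite ?nt ?pn ?Pn; lia.
Qed.

End CodePerm.

(** * Codes and chains *)

Section CodeChain.
Variable n : nat.
Implicit Types (v u : 'I_n.+1 -> letter n) (w : signed_perm n) (l r : letter n).

Definition code_split v w k : {set 'I_n} :=
  [set s : 'I_n | cpos v k (at_pos w s) != cpos v k (at_pos w s.+1)].

Lemma codes_mono v w k l l' : is_code v -> codes v w ->
  pos w l <= pos w l' -> cpos v k l <= cpos v k l'.
Proof. by move=> Hv M; rewrite -(codes_le _ _ M); apply: cpos_mono. Qed.

(** Rounded positions are odd and weakly increasing along the symmetric word, so they are constant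
    between dividers and jump at each divider. *)
Lemma eqv_code_split v w k l l' : is_code v -> codes v w ->
  eqv (split_partition w (code_split v w k)) l l' = (cpos v k l == cpos v k l').
Proof.
move=> Hv M; set S := code_split v w k.
have mono x x' : pos w x <= pos w x' -> cpos v k x <= cpos v k x' by apply: codes_mono.
have posat (s : 'I_n) : pos w (at_pos w s) = s%:Z by apply/pos_at_pos/ltnW.
have posat1 (s : 'I_n) : pos w (at_pos w s.+1) = s.+1%:Z by apply: pos_at_pos.
have nojump (s : 'I_n) x x' : s \in S -> cpos v k x = cpos v k x' ->
    pos w x <= s%:Z -> pos w x' <= s%:Z.
  rewrite inE => js E h; rewrite leNgt; apply/negP => h'.
  have h1 : cpos v k x <= cpos v k (at_pos w s) by apply: mono; rewrite posat.
  have h2 : cpos v k (at_pos w s.+1) <= cpos v k x' by apply: mono; rewrite posat1; lia.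
  have h3 : cpos v k (at_pos w s) <= cpos v k (at_pos w s.+1).
    by apply: mono; rewrite posat posat1; lia.
  by move: js; rewrite eq_le h3 /= (le_trans h2) // -E.
have climb i j : (i <= j <= n)%N -> (forall s : 'I_n, s \in S -> ~~ (i <= s < j)%N) ->
    cpos v k (at_pos w i) = cpos v k (at_pos w j).
  elim: j => [|j IH] /andP[ij jn] nS; first by have -> : i = 0%N by lia.
  move: ij; rewrite leq_eqVlt => /orP[/eqP -> //|]; rewrite ltnS => ij.
  rewrite IH ?ij 1?ltnW // => [|s /nS]; last by lia.
  have := nS (Ordinal jn); rewrite inE /= ij ltnSn; case: eqP => // _ /(_ isT) //.
have Pat x : 0 <= pos w x -> cpos v k x = cpos v k (at_pos w (absz (pos w x))).
  move=> x0; apply/cpos_same/(pos_inj (w := w)); rewrite pos_at_pos; first lia.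
  by have := pos_bound w x; lia.
have nonneg x x' : 0 <= pos w x -> 0 <= pos w x' ->
    (forall s, s \in S -> (pos w x <= s%:Z) = (pos w x' <= s%:Z)) ->
    cpos v k x = cpos v k x'.
  wlog le : x x' / pos w x <= pos w x' => [wl h h' H|].
    have [le|/ltW le] := leP (pos w x) (pos w x'); first exact: wl.
    by apply/esym/wl => // s Ss; rewrite H.
  move=> h h' H; rewrite (Pat x) // (Pat x') //; apply: climb.
    by have := pos_bound w x'; lia.
  by move=> s /H; lia.
apply/idP/eqP => [/eqv_split H|E]; last first.
  have En : cpos v k (neg l) = cpos v k (neg l') by rewrite !cpos_neg E.
  apply/eqv_split => s Ss; rewrite -!pos_neg.
  by split; apply/idP/idP; apply: nojump.
have Hn s : s \in S -> (pos w (neg l) <= s%:Z) = (pos w (neg l') <= s%:Z).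
  by rewrite !pos_neg => /H[].
have Hp s : s \in S -> (pos w l <= s%:Z) = (pos w l' <= s%:Z) by case/H.
have [pl|pl] := leP 0 (pos w l); have [pl'|pl'] := leP 0 (pos w l').
- exact: nonneg.
(* If no divider separates letters on opposite sides of 0, neither is separated from 0, and both
   rounded positions vanish. *)
- have -> : cpos v k l = cpos v k (ord0, false).
    by apply: nonneg; rewrite ?pos0 // => s /Hp; lia.
  have : cpos v k (neg l') = cpos v k (ord0, false).
    by apply: nonneg; rewrite ?pos_neg ?pos0 //; [lia | move=> s /Hn; rewrite !pos_neg; lia].
  by rewrite cpos_neg cpos_0; lia.
- have -> : cpos v k l' = cpos v k (ord0, false).
    by apply: nonneg; rewrite ?pos0 // => s /Hp; lia.
  have : cpos v k (neg l) = cpos v k (ord0, false).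
    by apply: nonneg; rewrite ?pos_neg ?pos0 //; [lia | move=> s /Hn; rewrite !pos_neg; lia].
  by rewrite cpos_neg cpos_0; lia.
have : cpos v k (neg l) = cpos v k (neg l').
  by apply: nonneg => //; rewrite pos_neg; lia.
by rewrite !cpos_neg; lia.
Qed.

Lemma code_split_sub v w j k : is_code v -> codes v w -> (j <= k)%N ->
  code_split v w k \subset code_split v w j.
Proof.
move=> Hv M jk; apply/subsetP => s; rewrite !inE; apply: contra => /eqP E.
by apply/eqP; apply: cpos_eq_mono E.
Qed.

(** The letter k+1 and its image under [v] have equal positions at level k+1 but not at level k. *)
Lemma code_split_neq v w k : is_code v -> codes v w -> (k < n)%N ->
  code_split v w k.+1 != code_split v w k.
Proof.
move=> Hv M kn; pose a : 'I_n.+1 := inord k.+1.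
have ak : a = k.+1 :> nat by rewrite inordK.
have a0 : a != ord0 by rewrite -val_eqE /= ak.
apply: contra_neq (cpos_neq Hv false a0 (Hv a a0)) => E.
have := eqv_code_split k.+1 (a, false) (v a) Hv M.
rewrite E eqv_code_split // (cposE Hv k.+1 a0) ak ltnn add0r eqxx => /eqP.
have hk : high k (v a).
  by have := Hv a a0; rewrite /high ak => /orP[->//|h]; rewrite (ltnW h) orbT.
rewrite -(cpos_high Hv (leq0n k) hk) -(cpos_high Hv (leq0n k)) //.
by rewrite /high /= ak leqnn orbT.
Qed.

(** The sets for levels 0, ..., n decrease strictly and the first has at most n elements. *)
Lemma card_code_split v w k : is_code v -> codes v w -> (k <= n)%N ->
  #|code_split v w k| = (n - k)%N.
Proof.
move=> Hv M kn.
have lt j : (j < n)%N -> (#|code_split v w j.+1| < #|code_split v w j|)%N.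
  move=> jn; apply: proper_card.
  by rewrite properEneq code_split_neq // code_split_sub.
have up j : (j <= n)%N -> (#|code_split v w j| + j <= n)%N.
  elim: j => [|j IH] jn; first by rewrite addn0 -[X in (_ <= X)%N]card_ord max_card.
  by have := lt j jn; have := IH (ltnW jn); lia.
have dn d : (d <= n)%N -> (d <= #|code_split v w (n - d)|)%N.
  elim: d => [//|d IH] dn; have := lt (n - d.+1)%N; rewrite -subSn // subSS.
  by move=> /(_ ltac:(lia)); have := IH (ltnW dn); lia.
by have := up k kn; have := dn (n - k)%N; rewrite subKn //; lia.
Qed.

Lemma mono_perm_ge (s : 'S_n) :
  (forall i j : 'I_n, (i < j)%N -> (s i < s j)%N) -> forall i : 'I_n, (i <= s i)%N.
Proof.
move=> sm i; case: i => i; elim: i => [|i IH] // hi.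
have h := IH (ltnW hi); apply: leq_ltn_trans h _.
exact: (sm (Ordinal (ltnW hi)) (Ordinal hi)).
Qed.

(** Two words inducing the same order differ by an increasing permutation, which is the identity. *)
Lemma codes_inj v w w' : codes v w -> codes v w' -> w = w'.
Proof.
move=> M M'; have MM l l' : (pos w l < pos w l') = (pos w' l < pos w' l') by rewrite -M M'.
pose s : 'S_n := (w.1 * w'.1^-1)%g.
have sE i : w.1 i = w'.1 (s i) by rewrite permM permKV.
have ps i : w.2 i = w'.2 (s i) /\
    pos w' (lift ord0 (w.1 i), w.2 i) = (s i).+1%:Z.
  have := MM (ord0, false) (lift ord0 (w.1 i), w.2 i).
  rewrite !pos0 posE eqxx sE posE; case: eqP => [->//|_]; lia.
have sm (i j : 'I_n) : (i < j)%N = (s i < s j)%N.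
  have := MM (lift ord0 (w.1 i), w.2 i) (lift ord0 (w.1 j), w.2 j).
  by rewrite !posE !eqxx (ps i).2 (ps j).2; lia.
have s1 i : s i = i.
  apply: val_inj; apply/eqP; rewrite eqn_leq; apply/andP; split; last first.
    by apply: mono_perm_ge => {}i j; rewrite sm.
  have := @mono_perm_ge (s^-1)%g _ (s i); rewrite permK; apply=> {}i j.
  by move=> ij; rewrite sm !permKV.
apply/eqP; rewrite -pair_eqE /=; apply/andP; split; apply/eqP.
  by apply/permP => i; rewrite sE s1.
by apply/ffunP => i; rewrite (ps i).1 s1.
Qed.
End CodeChain.

(** * Typed chains and their codes *)

Section TopCode.
Variable m : nat.
Local Notation n := m.+1.
Local Notation PP := (proper_part [set: signed_partition n]).
Implicit Types (t : m.-tuple (signed_partition n)) (v u : 'I_n.+1 -> letter n).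

Definition chain_code x0 t v := forall i, (i < m)%N -> forall l l',
  eqv (nth x0 t i) l l' = (cpos v i.+1 l == cpos v i.+1 l').

(** For a <= m the letter [a] is not a leader of x_a, hence is equivalent there to 0 or to a larger
    letter; any such letter may serve as [v a]. *)
Lemma typed_code x0 t : is_simplex PP t -> typed m t ->
  exists2 v, is_code v & chain_code x0 t v.
Proof.
move=> /andP[st _] tt.
have vex (a : 'I_n.+1) : exists l : letter n, high a l /\
    (a != ord0 -> (a <= m)%N -> eqv (nth x0 t a.-1) (a, false) l).
  have [am|am] := leqP a m; last first.
    (* For a = n only 0 is high. *)
    by exists (ord0, false); split; rewrite // /high eqxx.
  have [->|a0] := eqVneq a ord0; first by exists (ord0, false); rewrite /high eqxx.
  have a1 : (0 < a)%N by rewrite lt0n.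
  have : a \notin leaders (nth x0 t a.-1) by rewrite tt ?prednK // inE ltnn.
  by case/notin_leaders => [aE|[l hl el]]; [rewrite aE eqxx in a0 | exists l].
have [v vP] := choice vex.
have Hv : is_code v by move=> a _; case: (vP a).
exists v => // i im l l'.
have le a : (0 < a)%N -> (a <= i.+1)%N -> (nth x0 t a.-1 <= nth x0 t i)%O.
  move=> a0; rewrite leq_eqVlt => /orP[/eqP -> //|ai]; apply: ltW.
  by apply: sorted_nth_lt => //; rewrite size_tuple im andbT; lia.
(* Rounding at level i+1 drops the digits of the letters up to i+1, so a low letter can be moved
   along [v] to a high one within its class and without changing its rounded position. *)
have rep r : exists r', [/\ high i.+1 r', eqv (nth x0 t i) r r' & cpos v i.+1 r = cpos v i.+1 r'].
  elim/(code_ind Hv): r => [e|r [r' [h1 h2 h3]]|a a0 [r' [h1 h2 h3]]].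
  - by exists (ord0, e); rewrite eqv_refl /high eqxx.
  - by exists (neg r'); rewrite eqv_neg !cpos_neg h3.
  have [ai|ai] := leqP a i.+1; last by exists (a, false); rewrite eqv_refl /high ai orbT.
  have a1 : (0 < a)%N by rewrite lt0n.
  exists r'; split=> //; last by rewrite (cposE Hv) // ltnNge ai add0r.
  apply: eqv_trans h2; have [_ h] := vP a.
  by apply: eqv_le (le a a1 ai) (h a0 _); apply: leq_trans ai im.
have hi r : high i.+1 r -> is_rep (nth x0 t i) r.
  by rewrite /high /is_rep tt // inE.
have [r [h1 h2 h3]] := rep l; have [r' [h1' h2' h3']] := rep l'.
rewrite h3 h3'; apply/idP/eqP => [E|E].
  apply: cpos_same; apply: (rep_uniq (hi _ h1) (hi _ h1')).
  by rewrite eqv_sym in h2; apply: eqv_trans h2 (eqv_trans E h2').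
have {E} : cpos v 0 r = cpos v 0 r' by rewrite !(cpos_high Hv (leq0n i.+1)).
move/(cpos_inj Hv)/(eqv_same (nth x0 t i)) => E.
by rewrite eqv_sym in h2'; apply: eqv_trans h2 (eqv_trans E h2').
Qed.

(** Codes are compared through positions because, for instance, changing the bar on a value 0
    changes the code but no position. *)
Definition lex_lt v u := exists k : 'I_n.+1,
  (forall b : 'I_n.+1, (k < b)%N -> cpos v 0 (b, false) = cpos u 0 (b, false)) /\
  cpos v 0 (k, false) < cpos u 0 (k, false).

(** At the largest letter [k] whose positions differ, [v k] and [u k] are placed alike by both
    codes. If [v k] came first, [u k] would lie between [v k] and [k] in the word, and convexity
    would identify [v k] with [u k] in x_k, which separates high letters at distinct positions. *)
Lemma chain_code_lex x0 t v u w : is_code v -> is_code u -> chain_code x0 t v ->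
  codes u w -> (forall i, (i < m)%N -> nth x0 t i \in split_poset w) ->
  cpos v 0 =1 cpos u 0 \/ lex_lt u v.
Proof.
move=> Hv Hu tv M tw.
pose D (a : 'I_n.+1) := cpos v 0 (a, false) != cpos u 0 (a, false).
have [/existsP[a1 Da1]|] := boolP [exists a, D a]; last first.
  rewrite negb_exists => /forallP H; left => -[a e].
  have /eqP E := negPn (H a); case: e => //.
  by rewrite -[(a, true)]/(neg (a, false)) !cpos_neg E.
right; have [k Dk kmax] := @arg_maxnP _ a1 D (fun a => a : nat) Da1.
have E (b : 'I_n.+1) e : (k < b)%N -> cpos v 0 (b, e) = cpos u 0 (b, e).
  move=> kb; have {}E : cpos v 0 (b, false) = cpos u 0 (b, false).
    by apply/eqP; apply: contraT => /kmax /=; rewrite leqNgt kb.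
  by case: e => //; rewrite -[(b, true)]/(neg (b, false)) !cpos_neg E.
have Eh l : high k l -> cpos v 0 l = cpos u 0 l.
  by case: l => b e; rewrite /high /= => /orP[/eqP ->|/E //]; rewrite !cpos_0.
exists k; split; first by move=> b kb; rewrite E.
have k0 : k != ord0 by apply: contraNneq Dk => ->; rewrite /D !cpos_0.
have {Dk} : cpos v 0 (v k) != cpos u 0 (u k) by move: Dk; rewrite /D !cposE0 // (inj_eq (addrI _)).
rewrite !cposE0 // ltrD2l (Eh _ (Hv k k0)) => ne.
(* For k = n both values are 0 and the positions agree; so k <= m and x_k exists. *)
have km : (k.-1 < m)%N.
  case: (leqP k m) => km; first by have := k0; rewrite -val_eqE /=; lia.
  have z l : high k l -> cpos u 0 l = 0.
    case: l => b e; rewrite /high /= => /orP[/eqP ->|]; first by rewrite cpos_0.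
    by have := ltn_ord b; lia.
  by move: ne; rewrite !z ?eqxx //; [apply: Hu | apply: Hv].
have k1 : k.-1.+1 = k by rewrite prednK // lt0n.
rewrite lt_neqAle eq_sym ne leNgt; apply/negP => lt.
have e1 : eqv (nth x0 t k.-1) (v k) (k, false).
  by rewrite tv // k1 (cposE Hv k k0) ltnn add0r eqxx.
have ltk : cpos u 0 (u k) < cpos u 0 (k, false).
  by rewrite (cposE0 Hu k0); have := expn_gt0 3 k; lia.
have : eqv (nth x0 t k.-1) (v k) (u k).
  apply: (split_convex (tw _ km) _ _ e1); rewrite -(codes_le _ _ M); exact: ltW.
rewrite tv // k1 -!(cpos_high Hv (leq0n k)) ?Hu ?Hv // !Eh ?Hu ?Hv //.
exact/negP.
Qed.

End TopCode.

(** * Top homology and the cycle of a splitting poset *)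

Section TopHomology.
Variables (d : Order.disp_t) (T : finPOrderType d) (A : {set T}) (k : nat).
Hypothesis top : forall t : k.+1.-tuple T, is_simplex A t = false.

Lemma homology_class_sum (I : finType) (z : I -> chain_cycle A k) (a : I -> int) :
  \sum_i homology_class (z i) *~ a i = homology_class (\sum_i z i *~ a i).
Proof.
rewrite /homology_class raddf_sum; apply: eq_bigr => i _.
by rewrite raddfMz.
Qed.

(** Without simplices one dimension higher, the only boundary is 0. *)
Lemma homology_class_inj : injective (@homology_class d T A k).
Proof.
move=> z z' /eqP; rewrite -[_ == _]Quotient.idealrBE => /asboolP[c /forallP cA E].
have c0 : c = 0.
  apply/ffunP => t; rewrite ffunE; apply/eqP; apply: contraT => h.
  by have := implyP (cA t) h; rewrite top.
by apply/eqP; rewrite -subr_eq0 -val_eqE E c0 boundary0.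
Qed.

Lemma homology_class_surj (x : homology A k) : exists z, x = homology_class z.
Proof.
exists (generic_quotient.repr (x : Quotient.quot (boundaries A k))).
by rewrite /homology_class reprK.
Qed.

Lemma is_Zbasis_homology (I : finType) (z : I -> chain_cycle A k) :
  is_Zbasis z <-> is_Zbasis (fun i => homology_class (z i)).
Proof.
have cl0 : homology_class (0 : chain_cycle A k) = 0 by apply: raddf0.
split=> -[gen free]; split.
- move=> x; have [y ->] := homology_class_surj x; have [a ->] := gen y.
  by exists a; rewrite homology_class_sum.
- by move=> a; rewrite homology_class_sum -cl0 => /homology_class_inj/free.
- move=> y; have [a E] := gen (homology_class y); exists a.
  by apply: homology_class_inj; rewrite E homology_class_sum.
- by move=> a E; apply: free; rewrite homology_class_sum E.
Qed.
End TopHomology.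

(** Evaluations determine an element, and their matrix on the family is triangular for [key] with
    diagonal entries 1 or -1; elimination proceeds by increasing [key]. *)
Lemma triangular_Zbasis (M : zmodType) (I : finType) (e : I -> M)
    (ev : I -> M -> int) (key : I -> nat) :
  (forall j, zmod_morphism (ev j)) ->
  (forall i, ev i (e i) * ev i (e i) = 1) ->
  (forall i j, ev j (e i) != 0 -> i != j -> (key i < key j)%N) ->
  (forall x, (forall j, ev j x = 0) -> x = 0) -> is_Zbasis e.
Proof.
move=> evB diag tri sep.
have ev0 j : ev j 0 = 0 by rewrite -(subrr 0) evB subrr.
have evN j x : ev j (- x) = - ev j x by rewrite -sub0r evB ev0 sub0r.
have evD j x y : ev j (x + y) = ev j x + ev j y by rewrite -{1}[y]opprK evB evN opprK.
have evS j (F : I -> M) (Q : pred I) : ev j (\sum_(i | Q i) F i) = \sum_(i | Q i) ev j (F i).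
  by apply: (big_morph (ev j)) => [x y|]; rewrite ?evD ?ev0.
have evZn j x (a : nat) : ev j (x *+ a) = ev j x *+ a.
  by elim: a => [|a IH]; rewrite ?mulr0n ?ev0 // !mulrS evD IH.
have evZ j x a : ev j (x *~ a) = ev j x * a.
  by rewrite -mulrzz; case: a => a; rewrite ?NegzE ?mulrNz ?evN -?pmulrn ?evZn.
split.
  pose K := (\max_i key i).+1.
  have keyK i : (key i < K)%N by rewrite ltnS; apply: leq_bigmax.
  suff H N x : (N <= K)%N -> (forall j, (key j < K - N)%N -> ev j x = 0) ->
      exists a : I -> int, x = \sum_i e i *~ a i.
    by move=> x; apply: (H K) => // j; rewrite subnn.
  elim: N x => [|N IH] x NK Hx.
    exists (fun=> 0); rewrite (sep x) => [|j]; last by rewrite Hx // subn0.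
    by rewrite big1 // => i _; rewrite mulr0z.
  (* The diagonal entry is its own inverse, so multiplying by it divides by it. *)
  pose c i := if key i == (K - N.+1)%N then ev i x * ev i (e i) else 0.
  have [|a Ea] := IH (x - \sum_i e i *~ c i) (ltnW NK).
    move=> j jN; rewrite evB evS (bigD1 j) //= big1 ?addr0 => [|i ij].
      rewrite evZ /c; have [Ej|Ej] := eqVneq.
        by rewrite mulrCA diag mulr1 subrr.
      by rewrite mulr0 subr0 Hx //; move: jN Ej NK; clear; lia.
    rewrite evZ /c; case: eqP => [Ei|_]; last by rewrite mulr0.
    have [->|/tri/(_ ij) lt] := eqVneq (ev j (e i)) 0; first by rewrite mul0r.
    by exfalso; move: lt Ei jN NK; clear; lia.
  exists (fun i => a i + c i); rewrite -[LHS](subrK (\sum_i e i *~ c i)) Ea -big_split.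
  by apply: eq_bigr => i _; rewrite mulrzDr.
move=> a E i; apply/eqP; apply: contraT => ai.
(* The evaluation at a nonzero coefficient of least key sees no other term. *)
have [j aj jmin] := @arg_minnP _ i (fun i => a i != 0) key ai.
have := congr1 (ev j) E; rewrite ev0 evS (bigD1 j) //= big1 ?addr0 => [|i' ij].
  rewrite evZ => /eqP; rewrite mulf_eq0 (negbTE aj) orbF => /eqP h.
  by have := diag j; rewrite h mulr0.
rewrite evZ; have [->|/tri/(_ ij) lt] := eqVneq (ev j (e i')) 0; first by rewrite mul0r.
have [->|/jmin] := eqVneq (a i') 0; first by rewrite mulr0.
by rewrite leqNgt lt.
Qed.

(** * The fundamental cycle of a splitting poset *)

Section SplitCycle.
Variables (m : nat).
Local Notation n := m.+1.
Variable w : signed_perm n.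
Local Notation Aw := (proper_part (split_poset w)).
Implicit Types (s : 'S_n).

(** [s] is read as an order of removing dividers; this set is what remains after [k] removals. *)
Definition tail_set s (k : nat) : {set 'I_n} := [set s i | i : 'I_n & (k <= i)%N].

Definition perm_chain s : m.-tuple (signed_partition n) :=
  [tuple split_partition w (tail_set s j.+1) | j < m].

(** The barycentric subdivision of the boundary of the simplex on the dividers, oriented by signs of
    permutations. *)
Definition split_cycle : {ffun m.-tuple (signed_partition n) -> int} :=
  [ffun t => \sum_(s : 'S_n | perm_chain s == t) (-1) ^+ s].

Lemma in_tail_set s k i : (s i \in tail_set s k) = (k <= i)%N.
Proof. by rewrite mem_imset ?inE //; apply: perm_inj. Qed.

Lemma mem_tail_set s k x : (x \in tail_set s k) = (k <= (s^-1)%g x)%N.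
Proof. by rewrite -{1}(permKV s x) in_tail_set. Qed.

Lemma tail_set_sub s j k : (j <= k)%N -> tail_set s k \subset tail_set s j.
Proof.
move=> jk; apply/subsetP => x /imsetP[i]; rewrite inE => ki ->.
by rewrite in_tail_set; apply: leq_trans ki.
Qed.

Lemma split_partition_lt (S S' : {set 'I_n}) :
  S' \proper S -> (split_partition w S < split_partition w S')%O.
Proof.
rewrite properEneq => /andP[ne sS]; rewrite lt_neqAle split_partition_le // andbT.
by apply: contra_neq ne => /split_partition_inj.
Qed.

Lemma split_in_proper (S : {set 'I_n}) : S != set0 -> S != setT ->
  split_partition w S \in Aw.
Proof.
move=> S0 ST; rewrite inE imset_f //=; apply/andP; split.
  apply/negP => /forall_inP/(_ (split_partition w setT)); rewrite imset_f // => /(_ isT) h.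
  have := @split_partition_lt setT S; rewrite properT => /(_ ST).
  by rewrite lt_leAnge h andbF.
apply/negP => /forall_inP/(_ (split_partition w set0)); rewrite imset_f // => /(_ isT) h.
have := @split_partition_lt S set0; rewrite proper0 => /(_ S0).
by rewrite lt_leAnge h andbF.
Qed.

Lemma nth_perm_chain x0 s i : (i < m)%N ->
  nth x0 (perm_chain s) i = split_partition w (tail_set s i.+1).
Proof.
by move=> im; have := tnth_nth x0 (perm_chain s) (Ordinal im); rewrite tnth_mktuple.
Qed.

Lemma perm_chain_simplex s : is_simplex Aw (perm_chain s).
Proof.
apply/andP; split.
  apply/(sortedP (split_partition w set0)) => i; rewrite size_tuple => im.
  rewrite !nth_perm_chain ?(ltnW im) //; apply: split_partition_lt.
  have i1 : (i.+1 < n)%N by rewrite ltnS ltnW.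
  rewrite properE tail_set_sub //=; apply/subsetPn; exists (s (Ordinal i1)).
    by rewrite in_tail_set.
  by rewrite in_tail_set /= ltnn.
apply/allP => x /tnthP[i ->]; rewrite tnth_mktuple; apply: split_in_proper.
  apply/set0Pn; exists (s ord_max); rewrite in_tail_set; exact: ltn_ord.
by apply/eqP => /setP/(_ (s ord0)); rewrite in_tail_set in_setT.
Qed.

Lemma perm_chain_inj : injective perm_chain.
Proof.
move=> s s' E; have Et k : (k <= n)%N -> tail_set s k = tail_set s' k.
  case: k => [|k] kn.
    by apply/setP => x; rewrite !mem_tail_set.
  have [km|km] := ltnP k m.
    apply: (@split_partition_inj _ w).
    by rewrite -!(nth_perm_chain (split_partition w set0)) // E.
  have gt (i : 'I_n) : (k < i)%N = false by have := ltn_ord i; lia.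
  by apply/setP => x; rewrite !mem_tail_set !gt.
apply/permP => i; have := in_tail_set s i i; have := in_tail_set s i.+1 i.
rewrite !Et ?(ltn_ord i) ?(ltnW (ltn_ord i)) // leqnn ltnn.
rewrite !mem_tail_set => h1 h2.
have E' : (s'^-1)%g (s i) = i by apply: val_inj => /=; lia.
by rewrite -{2}E' permKV.
Qed.

(* Swapping the [i]-th and [i.+1]-st removed divider flips the sign and fixes the
   [i]-th face. *)
Lemma split_cycle_cycle : split_cycle \in cycles Aw m.
Proof.
apply/andP; split.
  apply/forallP => t; apply/implyP; rewrite ffunE => h.
  have [s /eqP <-|none] := pickP (fun s => perm_chain s == t).
    exact: perm_chain_simplex.
  by rewrite big_pred0 ?eqxx in h.
apply/eqP/ffunP => u; rewrite !ffunE.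
transitivity (\sum_(i < m) (-1) ^+ i *
    \sum_(s : 'S_n | face i (perm_chain s) == u) (-1) ^+ s : int).
  under eq_bigr => t _ do rewrite big_mkcond.
  rewrite exchange_big; apply: eq_bigr => i _ /=.
  under eq_bigr => t _ do rewrite ffunE.
  rewrite -big_mkcond /= -mulr_sumr; congr (_ * _).
  rewrite (partition_big perm_chain (fun t => face i t == u)) //=.
  apply: eq_bigr => t /eqP ft; apply: eq_bigl => s.
  by case: eqP => [->|]; rewrite ?andbF ?ft ?eqxx.
apply: big1 => i _; apply/eqP; rewrite mulf_eq0; apply/orP; right.
pose i0 : 'I_n := widen_ord (leqnSn m) i; pose i1 : 'I_n := lift ord0 i.
have ne : i0 != i1 by rewrite -val_eqE /= /bump /=; lia.
set f := \sum_(s | _) _.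
suff : f = - f by move=> /eqP; rewrite -addr_eq0 -mulr2n mulrn_eq0.
rewrite {1}/f (reindex_inj (mulgI (tperm i0 i1))) /= -sumrN; apply: eq_big => [s|s _].
  congr (_ == u); apply/eqP/(face_eqP _ _ _ (split_partition w set0)) => j jm ji.
  rewrite !nth_perm_chain //; congr split_partition; apply/setP => x.
  rewrite !mem_tail_set invMg permM tpermV; case: tpermP => [->|->|//].
    by rewrite /= /bump /=; lia.
  by rewrite /= /bump /=; lia.
by rewrite odd_mul_tperm ne signr_addb mulN1r.
Qed.

(** The permutation lists the elements in the order in which they leave the flag. *)
Lemma flag_perm (C : nat -> {set 'I_n}) :
  (forall k, (k <= n)%N -> #|C k| = (n - k)%N) ->
  (forall j k, (j <= k)%N -> C k \subset C j) ->
  exists s, forall k, (k <= n)%N -> tail_set s k = C k.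
Proof.
move=> card sub.
have ex (i : 'I_n) : exists x, x \in C i :\: C i.+1.
  apply/set0Pn; rewrite -card_gt0 cardsD (setIidPr (sub i i.+1 (leqnSn i))).
  rewrite !card //; last exact: ltnW.
  by have := ltn_ord i; lia.
have [f fP] := choice ex.
have f_inj : injective f.
  move=> i j; wlog ij : i j / (i < j)%N => [wl E|E].
    case: (ltngtP i j) => [ij|ji|/val_inj //]; first exact: wl.
    by apply/esym/wl.
  have := fP i; have := fP j; rewrite -E !inE => /andP[_ h] /andP[/negP[]].
  by apply: (subsetP (sub _ _ ij)).
exists (perm f_inj) => k kn; apply/eqP; rewrite eqEcard; apply/andP; split.
  apply/subsetP => x /imsetP[i]; rewrite inE permE => ki ->.
  by have := fP i; rewrite inE => /andP[_]; apply: (subsetP (sub _ _ ki)).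
by rewrite card // card_imset ?card_ord_ge //; apply: perm_inj.
Qed.

(** [split_cycle] is an integer multiple of [rho] and takes the value 1 or -1 at this chain, so the
    value of [rho] there is a unit. *)
Lemma fundamental_perm_chain (rho : chain_cycle Aw m) s :
  is_fundamental_cycle rho ->
  val rho (perm_chain s) * val rho (perm_chain s) = 1.
Proof.
move=> fund.
have top (t : n.-tuple (signed_partition n)) : is_simplex Aw t = false.
  apply/negP => /andP[st At]; have := no_long_simplex t (ltn0Sn m) (leqnn n).
  move/negP; apply; rewrite /is_simplex st; apply: sub_all At => x.
  exact/subsetP/proper_partS/subsetT.
have [gen _] : is_Zbasis (fun _ : unit => rho) by apply/is_Zbasis_homology.
have [a] := gen (Cycle split_cycle_cycle).
rewrite (bigD1 tt) //= big1 ?addr0 => [|[]] // E.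
have : split_cycle (perm_chain s) = val rho (perm_chain s) * a tt.
  have -> : split_cycle = val rho *~ a tt by rewrite -raddfMz -E.
  by rewrite ffunMzE mulrzz.
rewrite ffunE (eq_bigl (pred1 s)) ?big_pred1_eq => [|s']; last first.
  by rewrite (inj_eq perm_chain_inj).
move/(congr1 absz); rewrite abszM absz_sign => /esym/eqP.
rewrite muln_eq1 => /andP[/eqP h _]; move: h; move: (val rho _) => x.
by case: (ltP x 0) => x0 h; [have -> : x = -1 by lia | have -> : x = 1 by lia].
Qed.
End SplitCycle.

(** * The basis *)

Lemma cycle_valB d (T : finPOrderType d) (A : {set T}) k (z z' : chain_cycle A k) t :
  val (z - z') t = val z t - val z' t.
Proof.
have -> : val (z - z') = val z - val z' by exact: raddfB.
by move: (val z) (val z') => f g; rewrite !ffunE.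
Qed.

Section Assembly.
Variable m : nat.
Local Notation n := m.+1.
Local Notation PP := (proper_part [set: signed_partition n]).
Implicit Types (v u : 'I_n.+1 -> letter n).

Lemma cpos_determined v u k : is_code v -> is_code u ->
  cpos v 0 =1 cpos u 0 -> cpos v k =1 cpos u k.
Proof.
move=> Hv Hu E l; have := cpos_bound Hv l (leq0n k); have := cpos_bound Hu l (leq0n k).
have [z ->] := cpos_dvd Hv k l; have [y ->] := cpos_dvd Hu k l; rewrite E.
move: (3 ^ k.+1)%N => M h1 h2; have M0 : 0 < M%:Z by lia.
congr (_ * _); apply: le_anti; apply/andP; split.
  rewrite leNgt; apply/negP => zy; have : M%:Z * (y + 1) <= M%:Z * z.
    by rewrite (ler_pM2l M0); lia.
  by rewrite mulrDr mulr1; lia.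
rewrite leNgt; apply/negP => zy; have : M%:Z * (z + 1) <= M%:Z * y.
  by rewrite (ler_pM2l M0); lia.
by rewrite mulrDr mulr1; lia.
Qed.

Lemma lex_lt_irr v : ~ lex_lt v v.
Proof. by case=> k [_]; rewrite ltxx. Qed.

Lemma lex_lt_trans u v v' : lex_lt v u -> lex_lt u v' -> lex_lt v v'.
Proof.
case=> k [E lt] [k' [E' lt']]; case: (ltngtP k k') => kk.
- exists k'; split=> [b kb|]; first by rewrite E ?E' // (ltn_trans kk).
  by rewrite E.
- exists k; split=> [b kb|]; first by rewrite E ?E' // (ltn_trans kk).
  by rewrite -E'.
move/val_inj: kk => kk; exists k; split=> [b kb|]; first by rewrite E ?E' // -kk.
by apply: lt_trans lt _; rewrite kk.
Qed.

Definition code_chain v (w : signed_perm n) : m.-tuple (signed_partition n) :=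
  [tuple split_partition w (code_split v w j.+1) | j < m].

Lemma code_chainP x0 v w : is_code v -> codes v w -> chain_code x0 (code_chain v w) v.
Proof.
move=> Hv M i im l l'; have := tnth_nth x0 (code_chain v w) (Ordinal im).
by rewrite tnth_mktuple /= => <-; rewrite eqv_code_split.
Qed.

Lemma code_chain_perm v w : is_code v -> codes v w ->
  exists s, code_chain v w = perm_chain w s.
Proof.
move=> Hv M; have [s sE] : exists s, forall k, (k <= n)%N -> tail_set s k = code_split v w k.
  by apply: flag_perm => [k|j k]; [apply: card_code_split | apply: code_split_sub].
by exists s; apply: eq_from_tnth => j; rewrite !tnth_mktuple sE // ltnS ltnW.
Qed.

Lemma chain_code_eq x0 v w (t : m.-tuple (signed_partition n)) :
  is_code v -> codes v w -> chain_code x0 t v -> t = code_chain v w.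
Proof.
move=> Hv M tv; apply: eq_from_tnth => i; apply: eqv_inj => l l'.
by rewrite (tnth_nth x0) tv // tnth_mktuple eqv_code_split.
Qed.

Lemma split_simplex_nth w (t : m.-tuple (signed_partition n)) x0 i :
  is_simplex (proper_part (split_poset w)) t -> (i < m)%N ->
  nth x0 t i \in split_poset w.
Proof.
move=> /andP[_ /allP At] im; have := At (nth x0 t i).
rewrite mem_nth ?size_tuple // => /(_ isT).
by rewrite !inE => /andP[].
Qed.

(** Cycles are evaluated at the typed chains of the admissible permutations, which separate them by
    [cycle_vanish]. *)
Lemma split_cycles_Zbasis
    (rho : forall w : signed_perm n, chain_cycle (proper_part (split_poset w)) m)
    (rho_fundamental : forall w : signed_perm n, is_fundamental_cycle (rho w)) :
  @is_Zbasis (homology PP m) {w : signed_perm n | rl_maxima_unbarred w}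
    (fun w => homology_class
       (cycle_incl (proper_partS (subsetT (split_poset (sval w)))) (rho (sval w)))).
Proof.
apply/is_Zbasis_homology => [t|]; first exact: no_long_simplex.
pose I := {w : signed_perm n | rl_maxima_unbarred w}.
have ex (w : I) : exists v, is_code v /\ codes v (sval w).
  by have [v] := good_codes (svalP w); exists v.
have [V VP] := choice ex.
pose t (w : I) := code_chain (V w) (sval w).
(* Counting the lexicographically smaller codes turns the order into a numerical key. *)
pose key (w : I) := #|[set w' : I | `[< lex_lt (V w') (V w) >]]|.
have keyP w1 w2 : lex_lt (V w1) (V w2) -> (key w1 < key w2)%N.
  move=> lt; apply/proper_card/properP; split.
    apply/subsetP => w; rewrite !inE => /asboolP h; apply/asboolP; exact: lex_lt_trans lt.
  by exists w1; rewrite !inE; apply/asboolP => // /lex_lt_irr.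
pose x0 : signed_partition n := split_partition (1%g, [ffun=> false]) set0.
have supp (w : signed_perm n) (t' : m.-tuple (signed_partition n)) :
    val (rho w) t' != 0 -> is_simplex (proper_part (split_poset w)) t'.
  by case: (rho w) => z /= /andP[/forallP/(_ t')/implyP h _]; apply: h.
pose ev (w : I) (z : chain_cycle PP m) : int := val z (t w).
apply: (@triangular_Zbasis _ _ _ ev key).
- by move=> w z z'; apply: cycle_valB.
- move=> w; have [s sE] := code_chain_perm (VP w).1 (VP w).2.
  by rewrite /ev /= /t sE; apply: fundamental_perm_chain.
- move=> w1 w2 h ne; have st := supp (sval w1) (t w2) h; apply: keyP.
  have tw i : (i < m)%N -> nth x0 (t w2) i \in split_poset (sval w1).
    exact: split_simplex_nth.
  have [E|//] := chain_code_lex (VP w2).1 (VP w1).1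
     (code_chainP x0 (VP w2).1 (VP w2).2) (VP w1).2 tw.
  case/negP: ne; apply/eqP/val_inj; apply: (codes_inj (VP w1).2) => l l'.
  by rewrite -!E (VP w2).2.
move=> z zt; apply/val_inj/cycle_vanish; first exact: valP z.
move=> t1 st1 tt1; have [v Hv tv] := typed_code x0 st1 tt1.
have [w M] := code_perm Hv; pose w' : I := exist _ w (codes_good Hv M).
have [Hu Mu] := VP w'.
have inw u (Hu' : is_code u) (Mu' : codes u w) i : (i < m)%N ->
    nth x0 (code_chain u w) i \in split_poset w.
  have [s ->] := code_chain_perm Hu' Mu'; apply: split_simplex_nth.
  exact: perm_chain_simplex.
have t1E := chain_code_eq Hv M tv.
(* The code read off from [t1] and the one chosen for [w'] belong to the same permutation, whose
   splitting poset contains both chains. Comparison in both directions forces equal positions. *)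
have EP : cpos v 0 =1 cpos (V w') 0.
  have tv' : chain_code x0 (code_chain v w) v by rewrite -t1E.
  have [//|lt1] := chain_code_lex Hv Hu tv' Mu (inw v Hv M).
  have [E|lt2] := chain_code_lex Hu Hv (code_chainP x0 Hu Mu) M (inw _ Hu Mu).
    by move=> l; rewrite E.
  by case: (lex_lt_irr (lex_lt_trans lt1 lt2)).
suff -> : t1 = t w' by apply: zt.
rewrite t1E; apply: eq_from_tnth => i; rewrite !tnth_mktuple; congr split_partition.
by apply/setP => s; rewrite !inE !(cpos_determined _ Hv Hu EP).
Qed.
End Assembly.

Theorem theorem7p3 (n : nat) (n_gt0 : (0 < n)%N)
    (rho : forall w : signed_perm n,
       chain_cycle (proper_part (split_poset w)) n.-1)
    (rho_fundamental : forall w : signed_perm n, is_fundamental_cycle (rho w)) :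
  @is_Zbasis
    (homology (proper_part [set: signed_partition n]) n.-1)
    {w : signed_perm n | rl_maxima_unbarred w}
    (fun w => homology_class
       (cycle_incl (proper_partS (subsetT (split_poset (sval w))))
          (rho (sval w)))).
Proof.
case: n n_gt0 rho rho_fundamental => [//|m] _ rho rho_fundamental.
exact: split_cycles_Zbasis.
Qed.
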